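(* There is an algorithm which, given a function $F:D=\{x_1<\dots<x_n\}\to\mathbb{R}$ with $F(x_i)\neq F(x_{i+1})$ for $i=1,\dots,n-1$ and an integer $K\ge1$ such that $F$ has at least $K+1$ extrema, runs in time $O(nK)$ (hence in time linear in $n$ for fixed $K$) and returns an alternating segmentation of $D$ with at most $K$ segments whose OMAFE is minimal among all alternating segmentations of $D$ with at most $K$ segments.
   Context: Segmentations. A segmentation of $D$ into $K$ segments is a sequence of closed intervals $X_i=[y_i,y_{i+1}]$, $i=1,\dots,K$, given by segmentation points $y_1<\dots<y_{K+1}$ in $D$ with $y_1=\min D$, $y_{K+1}=\max D$. A segment $X_i$ is increasing if $F(\max X_i)>F(\min X_i)$, decreasing if $F(\max X_i)<F(\min X_i)$, and has no direction if these values are equal. A segmentation is alternating if its segments alternate between increasing and decreasing. OMAFE. For a segment $X$ that is increasing (resp. decreasing), $\mathrm{OMAFE}(F_{|X})=\min_{f}\max_{x\in D\cap X}|f(x)-F(x)|$, where $f:\mathbb{R}\to\mathbb{R}$ ranges over all (weakly) monotonic increasing (resp. decreasing) functions. For a segment with no direction the approximation is the best constant, with error $(\max F_{|X}-\min F_{|X})/2$. The OMAFE of a segmentation is the maximum of $\mathrm{OMAFE}(F_{|X_i})$ over its segments $X_i$. Extrema. $x_i$ is a maximum if ($i\neq1$ implies $F(x_i)>F(x_{i-1})$) and ($i\ne n$ implies $F(x_i)>F(x_{i+1})$). Minima are defined similarly. An extremum is a maximum or a minimum. Computational model. Unit-cost random access machine with unit-cost arithmetic and comparisons of the values of $F$.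 *)

(* Defs.v *)
From mathcomp Require Import all_boot all_order all_algebra.
From mathcomp Require Import boolp classical_sets reals.

Set Implicit Arguments.
Unset Strict Implicit.
Unset Printing Implicit Defensive.
Import Order.TTheory GRing.Theory Num.Theory.
Local Open Scope ring_scope.

(* The finite domain D is the increasing list of its elements, so D`_i stands
   for x_(i+1).  F is a total function, but everything below depends only on
   its values on D. *)

Section Segmentations.
Variables (R : realType) (D : seq R) (F : R -> R).

Definition is_maximum (i : nat) : bool :=
  ((i != 0%N) ==> (F D`_i.-1 < F D`_i)) &&
  ((i != (size D).-1) ==> (F D`_i.+1 < F D`_i)).

Definition is_minimum (i : nat) : bool :=
  ((i != 0%N) ==> (F D`_i < F D`_i.-1)) &&
  ((i != (size D).-1) ==> (F D`_i < F D`_i.+1)).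

Definition extrema : {set 'I_(size D)} :=
  [set i : 'I_(size D) | is_maximum i || is_minimum i].

(* The segment [a, b] is given by its end points. *)
Definition increasing_segment (a b : R) : bool := F a < F b.
Definition decreasing_segment (a b : R) : bool := F b < F a.

(* A segmentation is given by its segmentation points y_1 < ... < y_(k+1);
   since D is increasing, its head and last elements are min D and max D. *)
Definition nb_segments (y : seq R) : nat := (size y).-1.

Definition segmentation (y : seq R) : Prop :=
  [/\ (1 <= nb_segments y)%N,
      sorted <%R y,
      {subset y <= D},
      head 0 y = head 0 D &
      last 0 y = last 0 D].

(* Any two consecutive segments have opposite directions.  As soon as there are
   two segments this forces each of them to have a direction; the condition is
   void for a single segment, which may have no direction. *)
Definition alternating (y : seq R) : Prop :=
  forall i : nat, (i.+1 < nb_segments y)%N ->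
    (increasing_segment y`_i y`_i.+1 /\ decreasing_segment y`_i.+1 y`_i.+2) \/
    (decreasing_segment y`_i y`_i.+1 /\ increasing_segment y`_i.+1 y`_i.+2).

Definition sup_error (f : R -> R) (a b : R) : R :=
  \big[Num.max/0]_(x <- D | a <= x <= b) `|f x - F x|.

Definition nondecreasing_fun (f : R -> R) : Prop :=
  forall u v : R, u <= v -> f u <= f v.
Definition nonincreasing_fun (f : R -> R) : Prop :=
  forall u v : R, u <= v -> f v <= f u.

(* D being finite, the two infima are attained.  The base value F a of the
   iterated max and min is neutral when a belongs to D. *)
Definition OMAFE_segment (a b : R) : R :=
  if increasing_segment a b then
    inf [set sup_error f a b | f in nondecreasing_fun]%classic
  else if decreasing_segment a b then
    inf [set sup_error f a b | f in nonincreasing_fun]%classic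
  else (\big[Num.max/F a]_(x <- D | a <= x <= b) F x
        - \big[Num.min/F a]_(x <- D | a <= x <= b) F x) / 2.

Definition OMAFE (y : seq R) : R :=
  \big[Num.max/0]_(i < nb_segments y) OMAFE_segment y`_i y`_i.+1.

Definition alternating_segmentation_upto (K : nat) (y : seq R) : Prop :=
  [/\ segmentation y, alternating y & (nb_segments y <= K)%N].

Definition optimal_segmentation (K : nat) (y : seq R) : Prop :=
  alternating_segmentation_upto K y /\
  forall z : seq R, alternating_segmentation_upto K z -> OMAFE y <= OMAFE z.

End Segmentations.

(* A unit-cost random access machine with an integer memory and a real memory.
   A program is a fixed list of instructions, executed with a program counter.
   Integers carry only the additive operations (subtraction is truncated), and
   reals can never be converted to integers. *)

Inductive operand : Type :=
| Dir of nat    (* the cell with this address *)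
| Ind of nat.   (* the cell whose address is stored in this integer cell *)

(* The first operand of a non-jump instruction is the destination; a jump
   instruction ends with its target.  IJlt and RJlt jump when the first operand
   is less than the second one. *)
Inductive instr : Type :=
| IConst of operand & nat
| ICopy  of operand & operand
| IAdd   of operand & operand & operand
| ISub   of operand & operand & operand
| RConst of operand & nat
| RCopy  of operand & operand
| RAdd   of operand & operand & operand
| RSub   of operand & operand & operand
| RMul   of operand & operand & operand
| RDiv   of operand & operand & operand
| Jmp    of nat
| IJlt   of operand & operand & nat
| RJlt   of operand & operand & nat.

Definition program := seq instr.

Section RAM.
Variable R : realType.

Record state : Type := State {
  pc   : nat;
  imem : nat -> nat;
  rmem : nat -> R
}.

Definition update (T : Type) (m : nat -> T) (a : nat) (v : T) : nat -> T :=
  fun b => if b == a then v else m b.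

Definition address (s : state) (o : operand) : nat :=
  match o with Dir a => a | Ind a => imem s a end.

Definition ival (s : state) (o : operand) : nat := imem s (address s o).
Definition rval (s : state) (o : operand) : R := rmem s (address s o).

Definition iset (s : state) (o : operand) (v : nat) : state :=
  State (pc s).+1 (update (imem s) (address s o) v) (rmem s).
Definition rset (s : state) (o : operand) (v : R) : state :=
  State (pc s).+1 (imem s) (update (rmem s) (address s o) v).
Definition goto (s : state) (l : nat) : state := State l (imem s) (rmem s).

Definition exec (s : state) (i : instr) : state :=
  match i with
  | IConst d k => iset s d k
  | ICopy d a => iset s d (ival s a)
  | IAdd d a b => iset s d (ival s a + ival s b)%N
  | ISub d a b => iset s d (ival s a - ival s b)%N
  | RConst d k => rset s d k%:R
  | RCopy d a => rset s d (rval s a)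
  | RAdd d a b => rset s d (rval s a + rval s b)
  | RSub d a b => rset s d (rval s a - rval s b)
  | RMul d a b => rset s d (rval s a * rval s b)
  | RDiv d a b => rset s d (rval s a / rval s b)
  | Jmp l => goto s l
  | IJlt a b l => goto s (if (ival s a < ival s b)%N then l else (pc s).+1)
  | RJlt a b l => goto s (if rval s a < rval s b then l else (pc s).+1)
  end.

(* The machine halts when the program counter leaves the program; a halted
   machine no longer moves. *)
Definition halted (p : program) (s : state) : bool := (size p <= pc s)%N.

Definition step (p : program) (s : state) : state :=
  if onth p (pc s) is Some i then exec s i else s.

Definition run (p : program) (t : nat) (s : state) : state :=
  iter t (step p) s.

(* Input: integer cells 0 and 1 hold n = size D and K; real cells 0 .. n-1 hold
   the points of D, and real cells n .. 2n-1 the values of F at these points.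
   All other cells are 0. *)
Definition input (D : seq R) (F : R -> R) (K : nat) : state :=
  State 0 (nth 0%N [:: size D; K]) (nth 0 (D ++ map F D)).

(* Output: integer cell 0 holds the number k of segments, and real cells
   2n .. 2n+k hold the k+1 segmentation points. *)
Definition output (n : nat) (s : state) : seq R :=
  mkseq (fun j => rmem s (2 * n + j)%N) (imem s 0%N).+1.

End RAM.

(* Main.v *)
Require Import Defs.
From mathcomp Require Import all_boot all_order all_algebra.
From mathcomp Require Import boolp classical_sets reals.
From mathcomp Require Import zify lra.

(* For e > 0 call e-chain a sequence of points between which F moves alternately up and down by at
   least e.  If the drops of F in an alternating segmentation with k segments (its moves against
   the direction of the segment) are all less than e, then an e-chain has at most k steps.
   Conversely, the greedy zigzag, which turns as soon as F has moved back by e from its last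
   extremum, is an e-chain whose inner turning points cut D into as many segments with drops less
   than e.
   The OMAFE of a segment being half of its largest drop, this gives the algorithm: starting from
   a segmentation with largest drop e, run the greedy zigzag with threshold e; if it needs more
   than K segments the current segmentation is optimal, otherwise replace it by the greedy one.
   A drop of height e in a greedy segmentation with k segments can be inserted in the zigzag, which
   yields an e-chain with more than k steps; so the number of segments increases in each round,
   and there are O(K) rounds of cost O(n). *)

Import Order.TTheory GRing.Theory Num.Theory.
Local Open Scope ring_scope.

(** * Alternating signs and e-chains *)

Definition sgn {R : pzRingType} (s : R) (t : nat) : R := s * (-1) ^+ t.

Lemma sgn0 {R : pzRingType} (s : R) : sgn s 0 = s.
Proof. by rewrite /sgn expr0 mulr1. Qed.

Lemma sgnS {R : pzRingType} (s : R) t : sgn s t.+1 = - sgn s t.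
Proof. by rewrite /sgn exprSr mulrN1 mulrN. Qed.

Lemma sgn_cases {R : pzRingType} (s : R) t : sgn s t = s \/ sgn s t = - s.
Proof.
elim: t => [|t [IH|IH]]; rewrite ?sgn0 ?sgnS ?IH ?opprK; by [left|right].
Qed.

Section Chains.
Context {R : realFieldType}.
Variables (f : nat -> R) (A B : nat).

(* Some e-chain with m steps ends at c, with a last step of direction s (up if s = 1, down if
   s = -1). *)
Fixpoint chain_to (e : R) (m : nat) (s : R) (c : nat) : Prop :=
  if m is m'.+1 then
    exists b, [/\ (b < c <= B)%N, e <= s * f c - s * f b & chain_to e m' (- s) b]
  else (A <= c <= B)%N.

Lemma chain_to_bounds e m s c : chain_to e m s c -> (A <= c <= B)%N.
Proof.
by elim: m s c => [//|m IH] s c /= [b [bc _ /IH]]; lia.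
Qed.

Lemma chain_to_le e e' m s c : e' <= e -> chain_to e m s c -> chain_to e' m s c.
Proof.
move=> ee; elim: m s c => [//|m IH] s c /= [b [bc h /IH]].
by exists b; split=> //; lra.
Qed.

Lemma chain_to_trunc e m m' s c : (m' <= m)%N -> chain_to e m s c ->
  exists s' c', (s' = s \/ s' = - s) /\ chain_to e m' s' c'.
Proof.
elim: m s c => [|m IH] s c; first by rewrite leqn0 => /eqP -> ?; exists s, c; split; [left|].
rewrite leq_eqVlt => /orP[/eqP-> ?|]; first by exists s, c; split; [left|].
rewrite ltnS => /IH{}IH [b [_ _ /IH[s' [c' [ss ch]]]]].
by exists s', c'; split=> //; case: ss => ->; rewrite ?opprK; [right|left].
Qed.

Definition small_drops (e : R) (k : nat) (s : R) (y : nat -> nat) : Prop :=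
  forall t u v, (t < k)%N -> (y t <= u)%N -> (u < v)%N -> (v <= y t.+1)%N ->
    sgn s t * f u - sgn s t * f v < e.

(* A step of the chain of direction opposite to that of a segment cannot lie inside this
   segment; so the chain leaves at least one segment at each of its turning points. *)
Lemma chain_to_segment e k s0 y m s c :
  y 0%N = A -> y k = B -> (0 < k)%N -> small_drops e k s0 y ->
  s = s0 \/ s = - s0 -> chain_to e m.+1 s c ->
  exists t, [/\ (m <= t)%N, (t < k)%N, (y t < c)%N & sgn s0 t = s].
Proof.
move=> y0 yk k0 sm; elim: m s c => [|m IH] s c ss.
  move=> /= [b [bc h Ab]].
  (* A first step in the direction of segment 0 is charged to that segment; one in the opposite
     direction cannot end inside it and is charged to segment 1. *)
  have [se|sne] := eqVneq s s0.
    by exists 0%N; rewrite sgn0 se y0; split => //; lia.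
  have {ss sne} ss : s = - s0 by case: ss => // ss; rewrite ss eqxx in sne.
  have c1 : (y 1%N < c)%N.
    rewrite ltnNge; apply/negP => c1.
    have := sm 0%N b c k0; rewrite y0 sgn0.
    have Ab' : (A <= b)%N by lia.
    have bc' : (b < c)%N by lia.
    move=> /(_ Ab' bc' c1); subst s; lra.
  exists 1%N; rewrite sgnS sgn0; split=> //.
  rewrite ltn_neqAle k0 andbT; apply/eqP => k1; subst k; lia.
move=> [b [bc h ch]].
have ss' : - s = s0 \/ - s = - s0 by case: ss => ->; [right|left]; rewrite ?opprK.
have [t [mt tk yb st]] := IH _ _ ss' ch.
(* The new step starts after [y t] and runs against segment [t], so it must end beyond [y t.+1].
   Segment [t.+1] exists because [c] is at most [B = y k]. *)
have c1 : (y t.+1 < c)%N.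
  rewrite ltnNge; apply/negP => c1.
  have bc' : (b < c)%N by lia.
  have := sm t b c tk (ltnW yb) bc' c1; rewrite st; lra.
exists t.+1; rewrite sgnS st opprK; split=> //.
rewrite ltn_neqAle tk andbT; apply/eqP => k1; subst k; lia.
Qed.

Lemma chain_to_size e k s0 y m s c :
  y 0%N = A -> y k = B -> (0 < k)%N -> small_drops e k s0 y ->
  s = s0 \/ s = - s0 -> chain_to e m s c -> (m <= k)%N.
Proof.
case: m => [//|m] y0 yk k0 sm ss ch.
by have [t [mt tk _ _]] := chain_to_segment _ _ _ _ _ _ _ y0 yk k0 sm ss ch; lia.
Qed.

(** * The greedy zigzag and its extension by one point *)

Lemma update_eq (T : Type) (m : nat -> T) a v b : a = b -> update m a v b = v.
Proof. by move=> ->; rewrite /update eqxx. Qed.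

Lemma update_neq (T : Type) (m : nat -> T) a v b : a <> b -> update m a v b = m b.
Proof. by move=> ab; rewrite /update; case: eqP => // ba; case: ab. Qed.

(* The greedy zigzag of f on [A, q): its turning points are w 0 < ... < w k, where w k moves as long
   as f does not come back by e from it.  Step t has direction sgn s t. *)
Record zigzag (e : R) (k : nat) (s : R) (w : nat -> nat) (q : nat) : Prop := Zigzag {
  zz_first : (A <= w 0)%N;
  zz_last : (w k < q)%N;
  zz_lt : forall t, (t < k)%N -> (w t < w t.+1)%N;
  zz_step : forall t, (t < k)%N -> e <= sgn s t * f (w t.+1) - sgn s t * f (w t);
  zz_range : forall t x, (t < k)%N -> (w t <= x <= w t.+1)%N ->
    sgn s t * f (w t) <= sgn s t * f x <= sgn s t * f (w t.+1);
  zz_drop : small_drops e k s w;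
  zz_head : forall x, (A <= x <= w 0)%N -> s * f (w 0%N) <= s * f x < s * f (w 0%N) + e;
  zz_tail : forall x, (w k <= x < q)%N ->
    sgn s k * f (w k) <= sgn s k * f x < sgn s k * f (w k) + e }.

Lemma zigzag_keep e k s w q : zigzag e k s w q ->
  sgn s k * f (w k) <= sgn s k * f q < sgn s k * f (w k) + e ->
  zigzag e k s w q.+1.
Proof.
case=> h1 h2 h3 h4 h5 h6 h7 h8 hq; split=> //; first lia.
move=> x hx; have [->//|xq] := eqVneq x q; apply: h8; lia.
Qed.

(** When [q] is at least as extreme as the last turning point, the turning point moves to [q]. Only
    the last step changes, and it absorbs the old tail. *)
Lemma zigzag_move e k s w q : 0 < e -> zigzag e k.+1 s w q ->
  sgn s k.+1 * f q <= sgn s k.+1 * f (w k.+1) ->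
  zigzag e k.+1 s (update w k.+1 q) q.+1.
Proof.
move=> e0 [h1 h2 h3 h4 h5 h6 h7 h8] hq.
have w'E t : (t <= k)%N -> update w k.+1 q t = w t by move=> tk; rewrite update_neq //; lia.
have w'k : update w k.+1 q k.+1 = q by rewrite update_eq.
rewrite sgnS in hq h8.
have hk := h3 k (ltnSn k).
have hs := h4 k (ltnSn k).
(* Up to sign, no value before [q] exceeds that of the old turning point, and the values after it
   stay within [e] of it; so a drop ending in the old tail is less than [e]. *)
have dropk u v : (w k <= u)%N -> (u < v)%N -> (v <= q)%N -> sgn s k * f u - sgn s k * f v < e.
  move=> wu uv vq.
  have [v1|v1] := leqP v (w k.+1); first exact: h6.
  have fv : sgn s k * f (w k.+1) < sgn s k * f v + e.
    have [->|vq'] := eqVneq v q; first by lra.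
    have := h8 v; rewrite (ltnW v1) /= ltn_neqAle vq' vq => /(_ isT); lra.
  have fu : sgn s k * f u <= sgn s k * f (w k.+1).
    have [u1|u1] := leqP u (w k.+1);
      first by have := h5 k u (ltnSn k); rewrite wu u1 => /(_ isT); lra.
    have uq : (u < q)%N by lia.
    have := h8 u; rewrite (ltnW u1) uq => /(_ isT); lra.
  lra.
split.
- by rewrite w'E.
- by rewrite w'k.
- move=> t tk; rewrite (w'E t); last lia.
  have [tk'|tk'] := ltnP t k; first by rewrite w'E //; apply: h3; lia.
  have -> : t = k by lia.
  rewrite w'k; lia.
- move=> t tk; rewrite (w'E t); last lia.
  have [tk'|tk'] := ltnP t k; first by rewrite w'E //; apply: h4; lia.
  have -> : t = k by lia.
  rewrite w'k; lra.
- move=> t x tk; rewrite (w'E t); last lia.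
  have [tk'|tk'] := ltnP t k; first by rewrite w'E //; apply: h5; lia.
  have -> : t = k by lia.
  rewrite w'k => /andP[wx xq].
  have [x1|x1] := leqP x (w k.+1).
    by have := h5 k x (ltnSn k); rewrite wx x1 => /(_ isT); lra.
  have [->|xq'] := eqVneq x q; first by lra.
  have := h8 x; rewrite (ltnW x1) /= ltn_neqAle xq' xq => /(_ isT).
  lra.
- move=> t u v tk; rewrite (w'E t); last lia.
  have [tk'|tk'] := ltnP t k; first by rewrite w'E //; apply: h6; lia.
  have -> : t = k by lia.
  by rewrite w'k; apply: dropk.
- by move=> x; rewrite w'E //; apply: h7.
- rewrite w'k => x xq; have -> : x = q by lia.
  by rewrite lexx; lra.
Qed.

(** Here [q] is the first point at which [f] has come back by [e] from [w k]. By [zz_tail] all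
    earlier values since [w k] lie in a band of width less than [e], which bounds the drops of the
    new step and makes [q] its extreme point. *)
Lemma zigzag_turn e k s w q : 0 < e -> zigzag e k s w q ->
  sgn s k * f (w k) + e <= sgn s k * f q ->
  zigzag e k.+1 s (update w k.+1 q) q.+1.
Proof.
move=> e0 [h1 h2 h3 h4 h5 h6 h7 h8] hq.
have w'E t : (t <= k)%N -> update w k.+1 q t = w t by move=> tk; rewrite update_neq //; lia.
have w'k : update w k.+1 q k.+1 = q by rewrite update_eq.
split.
- by rewrite w'E.
- by rewrite w'k.
- move=> t tk; rewrite (w'E t); last lia.
  have [tk'|tk'] := ltnP t k; first by rewrite w'E //; apply: h3; lia.
  have -> : t = k by lia.
  by rewrite w'k.
- move=> t tk; rewrite (w'E t); last lia.
  have [tk'|tk'] := ltnP t k; first by rewrite w'E //; apply: h4; lia.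
  have -> : t = k by lia.
  rewrite w'k; lra.
- move=> t x tk; rewrite (w'E t); last lia.
  have [tk'|tk'] := ltnP t k; first by rewrite w'E //; apply: h5; lia.
  have -> : t = k by lia.
  rewrite w'k => /andP[wx xq].
  have [->|xq'] := eqVneq x q; first by lra.
  have := h8 x; rewrite wx /= ltn_neqAle xq' xq => /(_ isT); lra.
- move=> t u v tk; rewrite (w'E t); last lia.
  have [tk'|tk'] := ltnP t k; first by rewrite w'E //; apply: h6; lia.
  have -> : t = k by lia.
  rewrite w'k => wu uv vq.
  have uq : (u < q)%N by lia.
  have := h8 u; rewrite wu uq => /(_ isT) hu.
  have [->|vq'] := eqVneq v q; first by lra.
  have wv : (w k <= v)%N by lia.
  have := h8 v; rewrite wv /= ltn_neqAle vq' vq => /(_ isT); lra.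
- by move=> x; rewrite w'E //; apply: h7.
- rewrite w'k => x xq; have -> : x = q by lia.
  by rewrite lexx; lra.
Qed.

Lemma zigzag_start e s b q : 0 < e -> (A <= b)%N -> (b < q)%N ->
  (forall x, (A <= x < q)%N -> s * f b <= s * f x < s * f b + e) ->
  zigzag e 0 s (fun=> b) q.
Proof.
by move=> e0 Ab bq h; split=> // x hx; rewrite ?sgn0; apply: h; lia.
Qed.

(** The step arriving at [w t] is step number [t - 1], hence the sign [- sgn s t]. *)
Lemma zigzag_chain e k s w q : (q <= B.+1)%N -> zigzag e k s w q ->
  forall t, (t <= k)%N -> chain_to e t (- sgn s t) (w t).
Proof.
move=> qB [h1 h2 h3 h4 _ _ _ _].
have wk t : (t <= k)%N -> (w t <= w k)%N.
  move=> tk; rewrite -(subKn tk); elim: (k - t)%N => [|d IH]; first by rewrite subn0.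
  have [dk|dk] := leqP k d; first by have -> : (k - d.+1 = k - d)%N by lia.
  have := h3 (k - d.+1)%N; have -> : ((k - d.+1).+1 = k - d)%N by lia.
  lia.
elim=> [_|t IH tk].
  by have /= := wk 0%N; lia.
exists (w t); split; last by rewrite opprK sgnS; apply: IH; lia.
  by have := wk t.+1 tk; have := h3 t tk; lia.
by rewrite sgnS opprK; apply: h4.
Qed.

(** A chain that arrives at a turning point by a longer route can follow the zigzag from there on;
    this carries the gain of an inserted drop to the end. *)
Lemma zigzag_chain_from e e' k s w q p t : (q <= B.+1)%N -> zigzag e k s w q -> e' <= e ->
  chain_to e' p (- sgn s t) (w t) ->
  forall d, (t + d <= k)%N -> chain_to e' (p + d) (- sgn s (t + d)) (w (t + d)%N).
Proof.
move=> qB zz ee ch; elim=> [|d IH]; first by rewrite !addn0.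
rewrite !addnS => tdk; have := IH (ltnW tdk).
exists (w (t + d)%N); split.
- have := chain_to_bounds _ _ _ _ (zigzag_chain _ _ _ _ _ qB zz _ tdk).
  by have := zz_lt _ _ _ _ _ zz _ tdk; lia.
- by have := zz_step _ _ _ _ _ zz _ tdk; rewrite sgnS opprK; lra.
- by rewrite opprK sgnS.
Qed.

(* The first and the last turning points are replaced by the end points of the range. *)
Definition breakpoint (w : nat -> nat) (k t : nat) : nat :=
  if t == 0%N then A else if t == k then B else w t.

(** * The segmentation cut out by a zigzag *)

Section Breakpoints.
Variables (e : R) (k : nat) (s : R) (w : nat -> nat).
Hypotheses (e0 : 0 < e) (k0 : (0 < k)%N) (zz : zigzag e k s w B.+1).

Lemma breakpoint0 : breakpoint w k 0 = A. Proof. by []. Qed.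

Lemma breakpointk : breakpoint w k k = B.
Proof. by rewrite /breakpoint eqxx; case: eqP => // kk; lia. Qed.

Lemma breakpoint_le t : (t < k)%N ->
  (breakpoint w k t <= w t)%N /\ (w t.+1 <= breakpoint w k t.+1)%N.
Proof.
move=> tk; rewrite /breakpoint /=.
have := zz_first _ _ _ _ _ zz; have := zz_last _ _ _ _ _ zz; split.
  by case: (eqVneq t 0%N) => [->//|_]; case: (eqVneq t k) => [tk'|_] //; lia.
by case: (eqVneq t.+1 k) => [tk'|_] //; rewrite tk'; lia.
Qed.

Lemma breakpoint_lt t : (t < k)%N -> (breakpoint w k t < breakpoint w k t.+1)%N.
Proof.
by move=> tk; have := breakpoint_le _ tk; have := zz_lt _ _ _ _ _ zz _ tk; lia.
Qed.

(** Only the first segment extends to the left of its step, and there [zz_head] applies; otherwise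
    [x = w t]. *)
Lemma breakpoint_left t x : (t < k)%N -> (breakpoint w k t <= x)%N -> (x <= w t)%N ->
  sgn s t * f (w t) <= sgn s t * f x < sgn s t * f (w t) + e.
Proof.
have e1 := e0.
move=> tk; rewrite /breakpoint; case: (eqVneq t 0%N) => [->|_].
  by move=> Ax xw; rewrite sgn0; apply: (zz_head _ _ _ _ _ zz); lia.
case: (eqVneq t k) => [kk|_]; first by move: tk; rewrite kk ltnn.
move=> wx xw; have -> : x = w t by lia.
by rewrite lexx; lra.
Qed.

Lemma breakpoint_right t x : (t < k)%N -> (w t.+1 <= x)%N -> (x <= breakpoint w k t.+1)%N ->
  sgn s t * f (w t.+1) - e < sgn s t * f x <= sgn s t * f (w t.+1).
Proof.
have e1 := e0.
move=> tk; rewrite /breakpoint /=; case: (eqVneq t.+1 k) => [kk|_].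
  move=> wx xB; have := zz_tail _ _ _ _ _ zz x; rewrite -kk wx ltnS xB => /(_ isT).
  by rewrite sgnS; lra.
move=> wx xw; have -> : x = w t.+1 by lia.
by rewrite lexx; lra.
Qed.

Lemma breakpoint_range t x : (t < k)%N ->
  (breakpoint w k t <= x)%N -> (x <= breakpoint w k t.+1)%N ->
  sgn s t * f (w t) <= sgn s t * f x <= sgn s t * f (w t.+1).
Proof.
move=> tk x1 x2; have st := zz_step _ _ _ _ _ zz _ tk.
have [xw|wx] := leqP x (w t); first by have := breakpoint_left _ _ tk x1 xw; lra.
have [xw|wx'] := leqP x (w t.+1).
  by apply: (zz_range _ _ _ _ _ zz) => //; rewrite (ltnW wx).
by have := breakpoint_right _ _ tk (ltnW wx') x2; lra.
Qed.

Lemma breakpoint_drops : small_drops e k s (breakpoint w k).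
Proof.
move=> t u v tk u1 uv v2.
have v1 : (breakpoint w k t <= v)%N by lia.
have u2 : (u <= breakpoint w k t.+1)%N by lia.
have ru := breakpoint_range _ _ tk u1 u2; have rv := breakpoint_range _ _ tk v1 v2.
have [uw|wu] := leqP u (w t); first by have := breakpoint_left _ _ tk u1 uw; lra.
have [vw|wv] := leqP (w t.+1) v; first by have := breakpoint_right _ _ tk vw v2; lra.
by apply: (zz_drop _ _ _ _ _ zz) => //; lia.
Qed.

(** With at least two segments, one end of each segment is a true turning point. Replacing the other
    one by an end of the range loses less than [e], while the step is at least [e]. *)
Lemma breakpoint_direction t : (1 < k)%N -> (t < k)%N ->
  sgn s t * f (breakpoint w k t) < sgn s t * f (breakpoint w k t.+1).
Proof.
move=> k1 tk; have [b1 b2] := breakpoint_le _ tk.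
have st := zz_step _ _ _ _ _ zz _ tk.
have := breakpoint_left _ _ tk (leqnn _) b1; have := breakpoint_right _ _ tk b2 (leqnn _).
have [->|t0] := eqVneq t 0%N.
  have -> : breakpoint w k 1 = w 1%N by rewrite /breakpoint /=; case: eqP => // kk; lia.
  by rewrite sgn0; have := zz_step _ _ _ _ _ zz _ k0; rewrite sgn0; lra.
have -> : breakpoint w k t = w t.
  by rewrite /breakpoint (negbTE t0); case: eqP => // kk; lia.
lra.
Qed.

(* The segment of a drop [u < v] of height at least [e'] joins a minimum to a maximum of [F],
   up to sign, except for its part outside of the range of [w]; inserting [u] and [v],
   or appending one of them at an end of the zigzag, makes a longer chain. *)
Lemma breakpoint_progress e' t u v : 0 < e' -> e' <= e -> (t < k)%N ->
  (breakpoint w k t <= u)%N -> (u < v)%N -> (v <= breakpoint w k t.+1)%N ->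
  e' <= sgn s t * f u - sgn s t * f v ->
  exists s' c, (s' = s \/ s' = - s) /\ chain_to e' k.+1 s' c.
Proof.
move=> e'0 ee tk u1 uv v2 h.
have ss (j : nat) : - sgn s j = s \/ - sgn s j = - s.
  by case: (sgn_cases s j) => ->; rewrite ?opprK; [right|left].
have v1 : (breakpoint w k t <= v)%N by lia.
have u2 : (u <= breakpoint w k t.+1)%N by lia.
have ru := breakpoint_range _ _ tk u1 u2; have rv := breakpoint_range _ _ tk v1 v2.
have chk j jk := chain_to_le _ _ _ _ _ ee (zigzag_chain _ _ _ _ _ (leqnn _) zz j jk).
have vB : (v <= B)%N.
  move: v2; rewrite /breakpoint /=; case: eqP => // tk' vw.
  by have := chain_to_bounds _ _ _ _ (chk _ tk); lia.
have wtB : (w t <= B)%N by have := chain_to_bounds _ _ _ _ (chk _ (ltnW tk)); lia.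
have w1B : (w t.+1 <= B)%N by have := chain_to_bounds _ _ _ _ (chk _ tk); lia.
(* This is possible only for [t = 0]. As [f v] is not beyond the extreme value at [w 0], going from
   [u] to [w 0] is a step that can precede the whole zigzag. *)
have [uw|wu] := ltnP u (w t).
  have t0 : t = 0%N.
    case: (posnP t) => // t0; move: u1; rewrite /breakpoint; case: eqP => [|_]; first lia.
    case: eqP; lia.
  have ch : chain_to e' 1 (- sgn s 0) (w 0%N).
    exists u; subst t; split; [lia| by rewrite sgn0 in ru rv h *; lra |].
    by move: u1; rewrite breakpoint0 /=; lia.
  exists (- sgn s k), (w k); split; first exact: ss.
  exact: (zigzag_chain_from _ _ _ _ _ _ _ _ (leqnn _) zz ee ch k (leqnn k)).
have uw : (w t < u)%N.
  by rewrite ltn_neqAle wu andbT; apply/eqP => wu'; subst u; lra.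
have chu : chain_to e' t.+1 (sgn s t) u.
  exists (w t); split; [lia|lra|exact: chk (ltnW tk)].
have chv : chain_to e' t.+2 (- sgn s t) v.
  exists u; rewrite opprK; split; [lia|lra|by []].
(* If [v] is not before [w t.+1], the segment is the last one, since a drop cannot end at the
   maximum [w t.+1]. Then [u] and [v] replace [w k], which gives [k.+1] steps. *)
have [wv|vw] := leqP (w t.+1) v.
  have [tk'|tk'] := eqVneq t.+1 k.
    by exists (- sgn s t), v; rewrite -tk'; split.
  move: v2; rewrite /breakpoint /= (negbTE tk') => v2.
  have vE : v = w t.+1 by lia.
  subst v; lra.
have chw : chain_to e' t.+3 (- sgn s t.+1) (w t.+1).
  rewrite sgnS opprK; exists v; split; [lia|lra|by []].
have := zigzag_chain_from _ _ _ _ _ _ _ _ (leqnn _) zz ee chw (k - t.+1)%N.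
rewrite subnKC // => /(_ (leqnn _)).
(* Inserting both [u] and [v] adds two steps; the last step of the chain is dropped to leave
   [k.+1]. *)
have -> : (t.+3 + (k - t.+1) = k.+2)%N by lia.
move=> [b [_ _ ch]]; exists (- - sgn s k), b; split=> //.
by rewrite opprK; apply: sgn_cases.
Qed.

End Breakpoints.

(** The first segmentation comes from the extrema of the range instead of a zigzag. When it turns at
    a global extremum [h], a drop before [h] is continued to [h] and a drop after [h] is preceded by
    [h], which makes two steps. *)
Lemma peak_chain s h e t u v : (A <= h <= B)%N ->
  (forall x, (A <= x <= B)%N -> s * f x <= s * f h) -> 0 < e -> (t < 2)%N ->
  (breakpoint (fun=> h) 2 t <= u)%N -> (u < v)%N -> (v <= breakpoint (fun=> h) 2 t.+1)%N ->
  e <= sgn s t * f u - sgn s t * f v ->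
  exists s' c, (s' = s \/ s' = - s) /\ chain_to e 2 s' c.
Proof.
move=> Ah hh e0; case: t => [|[|//]] _; rewrite /breakpoint /= ?sgnS sgn0 => u1 uv v2 d.
  have := hh u; have := hh v; have -> : (A <= u <= B)%N by lia.
  have -> : (A <= v <= B)%N by lia.
  move=> /(_ isT) hv /(_ isT) hu.
  have vh : (v < h)%N by rewrite ltn_neqAle v2 andbT; apply/eqP => vh; subst v; lra.
  exists s, h; split; first by left.
  exists v; split; [lia|lra|exists u; split; [lia|lra|rewrite /=; lia]].
have := hh u; have := hh v; have -> : (A <= u <= B)%N by lia.
have -> : (A <= v <= B)%N by lia.
move=> /(_ isT) hv /(_ isT) hu.
have hu' : (h < u)%N by rewrite ltn_neqAle u1 andbT; apply/eqP => uh; subst u; lra.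
exists s, v; split; first by left.
exists u; split; [lia|lra|exists h; split; [lia|lra|rewrite /=; lia]].
Qed.

(** Counterpart for a first segmentation with one segment: as [A] is extremal, the drop is preceded
    by a step from [A] to [u]. *)
Lemma slope_chain s e u v : (forall x, (A <= x <= B)%N -> s * f A <= s * f x) -> 0 < e ->
  (A <= u)%N -> (u < v)%N -> (v <= B)%N -> e <= s * f u - s * f v ->
  chain_to e 2 (- s) v.
Proof.
move=> hh e0 Au uv vB d.
have := hh v; have -> : (A <= v <= B)%N by lia.
move=> /(_ isT) hv.
have Au' : (A < u)%N by rewrite ltn_neqAle Au andbT; apply/eqP => uh; subst u; lra.
exists u; split; [lia|lra|exists A; split; [lia|lra|rewrite /=; lia]].
Qed.

End Chains.

(** * Monotone approximation error and drops *)

Section Errors.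
Context {R : realType}.
Variables (D : seq R) (F : R -> R).

Lemma le_sup_error (f : R -> R) (a b u : R) :
  u \in D -> a <= u <= b -> `|f u - F u| <= sup_error D F f a b.
Proof.
move=> uD uab; exact: (le_bigmax_seq 0 u (fun x => a <= x <= b) (fun x => `|f x - F x|)).
Qed.

Lemma sup_error_le (f : R -> R) (a b e : R) : 0 <= e ->
  (forall u, u \in D -> a <= u <= b -> `|f u - F u| <= e) ->
  sup_error D F f a b <= e.
Proof.
move=> e0 He; rewrite /sup_error big_seq_cond; apply: bigmax_le => // u /andP[uD uab].
exact: He.
Qed.

Lemma sup_error_ge0 (f : R -> R) (a b : R) : 0 <= sup_error D F f a b.
Proof. exact: bigmax_ge_id. Qed.

Definition monotone (s : R) (f : R -> R) : Prop :=
  forall u v : R, u <= v -> s * f u <= s * f v.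

Lemma monotone1 : monotone 1 = @nondecreasing_fun R.
Proof.
apply/funext => f; apply/propext.
by split=> h u v uv; have := h u v uv; rewrite ?mul1r.
Qed.

Lemma monotoneN1 : monotone (- 1) = @nonincreasing_fun R.
Proof.
apply/funext => f; apply/propext.
by split=> h u v uv; have := h u v uv; rewrite ?mulN1r ?lerN2.
Qed.

Definition monotone_error (s a b : R) : R :=
  inf [set sup_error D F f a b | f in monotone s]%classic.

(** A monotone [f] cannot follow a drop: its errors at [u] and [v] add up to at least the height of
    the drop. *)
Lemma monotone_error_drop (s a b u v : R) : s = 1 \/ s = - 1 ->
  u \in D -> v \in D -> a <= u -> u <= v -> v <= b ->
  s * F u - s * F v <= 2 * monotone_error s a b.
Proof.
move=> s1 uD vD au uv vb.
suff : (s * F u - s * F v) / 2 <= monotone_error s a b by lra.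
apply: lb_le_inf.
  by exists (sup_error D F (fun=> 0) a b); exists (fun=> 0) => // ? ? _; rewrite mulr0.
move=> _ [f fs <-].
have := le_sup_error f _ _ _ uD (_ : a <= u <= b).
rewrite au (le_trans uv vb) => /(_ isT).
have := le_sup_error f _ _ _ vD (_ : a <= v <= b).
rewrite vb (le_trans au uv) => /(_ isT).
rewrite !ler_norml => /andP[h1 h2] /andP[h3 h4].
by have := fs u v uv; case: s1 => ->; lra.
Qed.

(* The best monotone approximation is the running maximum, lowered by half of the largest drop. *)
Lemma monotone_error_le (s a b e : R) : s = 1 \/ s = - 1 -> 0 <= e -> a \in D ->
  (forall u v, u \in D -> v \in D -> a <= u -> u <= v -> v <= b -> s * F u - s * F v <= e) ->
  monotone_error s a b <= e / 2.
Proof.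
move=> s1 e0 aD He.
have ss : s * s = 1 by case: s1 => ->; rewrite ?mulr1 ?mulrNN ?mulr1.
(* For [x < a] the range is empty and [top] has the constant value [s * F a], so [f] is monotone on
   the whole line; for [a <= x] this initial value is one of the terms. *)
pose top x := \big[Num.max/s * F a]_(u <- D | a <= u <= x) (s * F u).
pose f x := s * (top x - e / 2).
have fs : monotone s f.
  move=> x y xy; rewrite /f !mulrA ss !mul1r lerD2r /top.
  by apply: sub_bigmax => u /andP[-> ux]; apply: le_trans xy.
apply: (@le_trans _ _ (sup_error D F f a b)).
  apply: ge_inf; last by exists f.
  by exists 0 => _ [g _ <-]; apply: sup_error_ge0.
apply: sup_error_le => [|u uD /andP[au ub]]; first lra.
have t1 : s * F u <= top u.
  by apply: (le_bigmax_seq _ u (fun x => a <= x <= u) (fun x => s * F x)); rewrite ?au ?lexx.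
have t2 : top u <= s * F u + e.
  rewrite /top big_seq_cond; apply: bigmax_le => [|v /andP[vD /andP[av vu]]].
    by have := He a u aD uD (lexx a) au ub; lra.
  by have := He v u vD uD av vu ub; lra.
rewrite /f ler_norml; case: s1 t1 t2 => -> t1 t2; apply/andP; split; lra.
Qed.

Lemma OMAFE_segmentE (s a b : R) : s = 1 \/ s = - 1 -> s * F a < s * F b ->
  OMAFE_segment D F a b = monotone_error s a b.
Proof.
rewrite /OMAFE_segment /increasing_segment /decreasing_segment /monotone_error.
case=> ->; first by rewrite !mul1r monotone1 => ->.
by rewrite !mulN1r ltrN2 monotoneN1 => ba; rewrite ba ltNge (ltW ba).
Qed.

(** The weak inequality admits a segment with no direction: its error is half of the full range of
    [F], which dominates the drops of both directions. *)
Lemma OMAFE_segment_drop (s a b u v : R) : s = 1 \/ s = - 1 -> s * F a <= s * F b ->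
  u \in D -> v \in D -> a <= u -> u <= v -> v <= b ->
  s * F u - s * F v <= 2 * OMAFE_segment D F a b.
Proof.
move=> s1; rewrite le_eqVlt => /orP[/eqP ab|ab]; last first.
  by rewrite (OMAFE_segmentE _ _ _ s1 ab); apply: monotone_error_drop.
have {}ab : F a = F b by case: s1 ab => ->; lra.
move=> uD vD au uv vb.
rewrite /OMAFE_segment /increasing_segment /decreasing_segment ab ltxx.
rewrite mulrCA divff ?pnatr_eq0 // mulr1.
have P x : x = u \/ x = v -> a <= x <= b.
  by case=> ->; rewrite ?au ?vb ?(le_trans au uv) ?(le_trans uv vb).
have h x (xD : x \in D) (hx : a <= x <= b) := le_bigmax_seq (F b) x (fun x => a <= x <= b) F xD hx.
have h' x (xD : x \in D) (hx : a <= x <= b) := ge_bigmin_seq (F b) x (fun x => a <= x <= b) F xD hx.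
have := h u uD (P _ (or_introl erefl)); have := h v vD (P _ (or_intror erefl)).
have := h' u uD (P _ (or_introl erefl)); have := h' v vD (P _ (or_intror erefl)).
by case: s1 => ->; lra.
Qed.

Lemma OMAFE_ge (y : seq R) (i : nat) : (i < nb_segments y)%N ->
  OMAFE_segment D F y`_i y`_i.+1 <= OMAFE D F y.
Proof. by move=> iy; rewrite /OMAFE; apply: (le_bigmax _ _ (Ordinal iy)). Qed.

End Errors.

(** * Segmentations given by addresses, and the lower bound on their error *)

Section Points.
Context {R : realType}.
Variables (D : seq R) (F : R -> R).
Hypotheses (sD : sorted <%R D) (n1 : (1 < size D)%N).
Let n := size D.

(* The points of D are indexed by the addresses of their images under F in the input. *)
Definition abscissa (q : nat) : R := D`_(q - n).
Definition height (q : nat) : R := F (abscissa q).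

Lemma abscissa_in q : (n <= q < 2 * n)%N -> abscissa q \in D.
Proof. by move=> hq; apply: mem_nth; rewrite -/n; lia. Qed.

Lemma abscissa_lt u v : (n <= u)%N -> (u < v)%N -> (v < 2 * n)%N -> abscissa u < abscissa v.
Proof.
move=> nu uv vn; rewrite /abscissa lt_sorted_ltn_nth // ?inE -/n; lia.
Qed.

Lemma abscissa_le u v : (n <= u)%N -> (u <= v)%N -> (v < 2 * n)%N -> abscissa u <= abscissa v.
Proof.
move=> nu; rewrite leq_eqVlt => /orP[/eqP->//|uv] vn; apply: ltW; exact: abscissa_lt.
Qed.

Lemma abscissa_onto x : x \in D -> exists2 q, (n <= q < 2 * n)%N & x = abscissa q.
Proof.
move=> xD; exists (n + index x D)%N; first by move: xD; rewrite -index_mem -/n; lia.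
by rewrite /abscissa addKn nth_index.
Qed.

Lemma abscissa_le_inv u v : (n <= u < 2 * n)%N -> (n <= v < 2 * n)%N ->
  abscissa u <= abscissa v -> (u <= v)%N.
Proof.
move=> hu hv uv; rewrite leqNgt; apply/negP => vu.
have : abscissa v < abscissa u by apply: abscissa_lt; lia.
by rewrite ltNge uv.
Qed.

Lemma abscissa_first : abscissa n = head 0 D.
Proof. by rewrite /abscissa subnn nth0. Qed.

Lemma abscissa_last : abscissa (2 * n).-1 = last 0 D.
Proof. by rewrite -nth_last /abscissa; congr nth; rewrite -/n; lia. Qed.

(** The optimality certificate. An error below [e / 2] would make all drops of [z] less than [e],
    and then [chain_to_size] allows at most [K] steps. *)
Lemma OMAFE_chain_ge K z e s c : alternating_segmentation_upto D F K z ->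
  s = 1 \/ s = - 1 -> chain_to height n (2 * n).-1 e K.+1 s c -> e / 2 <= OMAFE D F z.
Proof.
move=> [[k0 sz zD hz lz] alt kK] s1 ch; rewrite leNgt; apply/negP => small.
set k := nb_segments z in k0 kK.
have szE : size z = k.+1 by move: k0; rewrite /k /nb_segments; lia.
pose y t := (n + index (z`_t)%R D)%N.
have zin t : (t <= k)%N -> z`_t \in D by move=> tk; apply/zD/mem_nth; rewrite szE.
have yE t : (t <= k)%N -> abscissa (y t) = z`_t.
  by move=> tk; rewrite /abscissa /y addKn nth_index // zin.
have yn t : (t <= k)%N -> (n <= y t < 2 * n)%N.
  by move=> /zin; rewrite -index_mem /y -/n; lia.
(* A single segment with no direction is counted as increasing; otherwise alternation propagates the
   sign of the first segment. *)
pose s0 : R := if F z`_0 <= F z`_1 then 1 else -1.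
have sg t : sgn s0 t = 1 \/ sgn s0 t = - 1.
  by rewrite /s0; case: (sgn_cases s0 t) => ->; rewrite /s0; case: ifP => _; rewrite ?opprK; auto.
have dir t : (t < k)%N -> sgn s0 t * F z`_t <= sgn s0 t * F z`_t.+1.
  elim: t => [|t IH] tk.
    rewrite sgn0 /s0; case: (leP (F z`_0) (F z`_1)) => h; rewrite ?mul1r // !mulN1r lerN2.
    exact: ltW.
  have := IH (ltnW tk); rewrite sgnS; have := alt t tk.
  rewrite /increasing_segment /decreasing_segment.
  by case: (sg t) => ->; case=> -[]; lra.
have sm : small_drops height e k s0 y.
  move=> t u v tk yu uv vy.
  have yt := yn t (ltnW tk); have yt1 := yn t.+1 tk.
  have := OMAFE_segment_drop D F _ _ _ (abscissa u) (abscissa v) (sg t) (dir t tk).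
  rewrite !abscissa_in; [|lia..].
  rewrite -(yE t) ?(ltnW tk) // -(yE t.+1) //.
  rewrite !abscissa_le; [|lia..].
  move=> /(_ isT isT isT isT isT).
  rewrite (yE t) ?(ltnW tk) // (yE t.+1) //.
  by have := OMAFE_ge D F z t tk; rewrite /height; lra.
have y0 : y 0%N = n.
  by rewrite /y nth0 hz; case: (D) n1 => [//|x D'] _ /=; rewrite eqxx addn0.
have yk : y k = (2 * n).-1.
  apply/eqP; rewrite eqn_leq; apply/andP; split; first by have := yn k (leqnn k); lia.
  apply: abscissa_le_inv; [lia|exact: yn|].
  by rewrite yE // abscissa_last -lz -nth_last szE.
have := chain_to_size _ _ _ _ _ _ _ _ _ _ y0 yk k0 sm _ ch.
have ss : s = s0 \/ s = - s0.
  by rewrite /s0; case: s1 => ->; case: ifP => _; rewrite ?opprK; auto.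
by move=> /(_ ss); lia.
Qed.

Section Segmentation_of_addresses.
Variables (k : nat) (P : nat -> nat).
Hypotheses (k0 : (0 < k)%N) (P0 : P 0%N = n) (Pk : P k = (2 * n).-1).
Hypothesis Plt : forall t, (t < k)%N -> (P t < P t.+1)%N.
Let z := mkseq (fun t => abscissa (P t)) k.+1.

Lemma nb_segments_points : nb_segments z = k.
Proof. by rewrite /nb_segments size_mkseq. Qed.

Lemma nth_points t : (t <= k)%N -> z`_t = abscissa (P t).
Proof. by move=> tk; rewrite nth_mkseq. Qed.

Lemma addresses_bounds t : (t <= k)%N -> (n <= P t < 2 * n)%N.
Proof.
have lo d : (d <= k)%N -> (n <= P d)%N.
  by elim: d => [|d IH] dk; rewrite ?P0 //; have := IH (ltnW dk); have := Plt d dk; lia.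
have hi d : (d <= k)%N -> (P (k - d) <= (2 * n).-1)%N.
  elim: d => [|d IH] dk; first by rewrite subn0 Pk.
  have := IH (ltnW dk); have := Plt (k - d.+1)%N; have -> : ((k - d.+1).+1 = k - d)%N by lia.
  lia.
by move=> tk; have := lo t tk; have := hi (k - t)%N; rewrite subKn //; lia.
Qed.

Lemma segmentation_points : segmentation D z.
Proof.
split.
- by rewrite nb_segments_points.
- apply/(sortedP 0) => i; rewrite size_mkseq => ik.
  rewrite !nth_points; [|lia..].
  have := addresses_bounds i; have := addresses_bounds i.+1; have := Plt i.
  by move=> h1 h2 h3; apply: abscissa_lt; lia.
- move=> x /mapP[t]; rewrite mem_iota => tk ->.
  by apply/abscissa_in/addresses_bounds; lia.
- by rewrite -nth0 nth_points // P0 abscissa_first.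
- by rewrite -nth_last size_mkseq nth_points // Pk abscissa_last.
Qed.

Variable s : R.
Hypotheses (s1 : s = 1 \/ s = - 1) (dir : forall t, (t < k)%N ->
  sgn s t * height (P t) < sgn s t * height (P t.+1)).

Lemma sgn_unit t : sgn s t = 1 \/ sgn s t = - 1.
Proof. by case: (sgn_cases s t) => ->; case: s1 => ->; rewrite ?opprK; auto. Qed.

Lemma alternating_points : alternating F z.
Proof.
move=> t; rewrite nb_segments_points => tk.
rewrite !nth_points; [|lia..].
rewrite /increasing_segment /decreasing_segment.
have := dir t (ltnW tk); have := dir t.+1 tk; rewrite sgnS /height.
by case: (sgn_unit t) => ->; rewrite ?opprK ?mul1r ?mulN1r ?ltrN2; auto.
Qed.

(** Every point of [D] in a segment is the abscissa of an address in its range, so the bound on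
    drops between addresses is the one that [monotone_error_le] asks for. *)
Lemma OMAFE_points_le e : 0 <= e ->
  (forall t u v, (t < k)%N -> (P t <= u)%N -> (u < v)%N -> (v <= P t.+1)%N ->
    sgn s t * height u - sgn s t * height v <= e) ->
  OMAFE D F z <= e / 2.
Proof.
move=> e0 He; rewrite /OMAFE; apply: bigmax_le => [|i _]; first lra.
move: (nat_of_ord i) (ltn_ord i) => t; rewrite nb_segments_points => tk.
rewrite !nth_points; [|lia..].
rewrite (OMAFE_segmentE _ _ _ _ _ (sgn_unit t) (dir t tk)).
have Bt := addresses_bounds t (ltnW tk); have Bt1 := addresses_bounds t.+1 tk.
apply: monotone_error_le; [exact: sgn_unit|exact: e0|exact: abscissa_in|].
move=> _ _ /abscissa_onto[u hu ->] /abscissa_onto[v hv ->] Pu uv vP.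
have {}Pu := abscissa_le_inv _ _ Bt hu Pu.
have {}vP := abscissa_le_inv _ _ hv Bt1 vP.
have := abscissa_le_inv _ _ hu hv uv; rewrite leq_eqVlt => /orP[/eqP->|{}uv];
  first by rewrite subrr.
exact: He tk Pu uv vP.
Qed.

End Segmentation_of_addresses.

(** For [K = 1] there is only one candidate. It is treated apart because it may have no
    direction. *)
Lemma optimal_one_segment : optimal_segmentation D F 1 [:: abscissa n; abscissa (2 * n).-1].
Proof.
have seg : segmentation D [:: abscissa n; abscissa (2 * n).-1].
  by apply: (segmentation_points 1 (fun t => if t == 0%N then n else (2 * n).-1)) => //=
    -[|t] //= _; lia.
split; first by split.
move=> z [[k1 _ _ hz lz] _ k1'].
case: z k1 k1' hz lz => [//|a [//|b [|//]]] _ _ /= -> ->.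
by rewrite abscissa_first abscissa_last.
Qed.

End Points.

(** * The program and its execution in bounded time *)

Section Machine.
Context {R : realType}.
Variables (D : seq R) (F : R -> R) (K : nat).
Local Notation n := (size D).
Local Notation f := (height D F).

(* Integer cells: 1-10 and 20 hold K, 1, n, 2n, 2n-1, the addresses of the real cells E, s, T,
   rate and zero, and the base of an array of turning points stored from cell 21 on; points are
   represented by the addresses of their images under F.
   Instructions 12-29 look for the first index at which the range of F reaches E, 30-51 extend the
   zigzag from there, 52-82 output the segmentation and store its largest drop in E.
   In the first round rate = 0, so that 12-29 compute the extrema of F and 89-103 use
   them to build a first segmentation. *)
Definition zigzag_program : program :=
  [:: IConst (Dir 2) 1; ICopy (Dir 3) (Dir 0); IAdd (Dir 4) (Dir 0) (Dir 0);
      ISub (Dir 5) (Dir 4) (Dir 2); IAdd (Dir 6) (Dir 4) (Dir 1); IAdd (Dir 6) (Dir 6) (Dir 2);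
      IAdd (Dir 7) (Dir 6) (Dir 2); IAdd (Dir 8) (Dir 7) (Dir 2); IAdd (Dir 9) (Dir 8) (Dir 2);
      IAdd (Dir 10) (Dir 9) (Dir 2);
   (* 10 *)
      IConst (Dir 20) 21; RConst (Ind 6) 1; ICopy (Dir 11) (Dir 3); ICopy (Dir 12) (Dir 3);
      ICopy (Dir 21) (Dir 3); IAdd (Dir 13) (Dir 3) (Dir 2); IJlt (Dir 13) (Dir 4) 18; Jmp 89;
      RJlt (Ind 13) (Ind 11) 21; RJlt (Ind 12) (Ind 13) 23;
   (* 20 *)
      Jmp 28; ICopy (Dir 11) (Dir 13); Jmp 24; ICopy (Dir 12) (Dir 13);
      RSub (Ind 8) (Ind 12) (Ind 11); RMul (Ind 8) (Ind 8) (Ind 9); RJlt (Ind 8) (Ind 6) 28;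
      Jmp 30; IAdd (Dir 13) (Dir 13) (Dir 2); Jmp 16;
   (* 30 *)
      IConst (Dir 14) 1; RConst (Ind 7) 1; IJlt (Dir 11) (Dir 12) 35;
      RSub (Ind 7) (Ind 10) (Ind 7); ICopy (Dir 12) (Dir 11); IAdd (Dir 13) (Dir 13) (Dir 2);
      IJlt (Dir 13) (Dir 4) 38; Jmp 52; RSub (Ind 8) (Ind 12) (Ind 13);
      RMul (Ind 8) (Ind 8) (Ind 7);
   (* 40 *)
      RJlt (Ind 8) (Ind 6) 48; IAdd (Dir 15) (Dir 20) (Dir 14); ICopy (Ind 15) (Dir 12);
      ICopy (Dir 12) (Dir 13); RSub (Ind 7) (Ind 10) (Ind 7); IAdd (Dir 14) (Dir 14) (Dir 2);
      IJlt (Dir 1) (Dir 14) 104; Jmp 35; RJlt (Ind 8) (Ind 10) 50; Jmp 35;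
   (* 50 *)
      ICopy (Dir 12) (Dir 13); Jmp 35; IAdd (Dir 15) (Dir 20) (Dir 14); ICopy (Ind 15) (Dir 5);
      ICopy (Dir 0) (Dir 14); RCopy (Ind 6) (Ind 10); IConst (Dir 16) 0;
      IAdd (Dir 15) (Dir 20) (Dir 16); ICopy (Dir 17) (Ind 15); ISub (Dir 19) (Dir 17) (Dir 3);
   (* 60 *)
      IAdd (Dir 15) (Dir 4) (Dir 16); RCopy (Ind 15) (Ind 19); IJlt (Dir 16) (Dir 14) 64; Jmp 83;
      IAdd (Dir 16) (Dir 16) (Dir 2); IAdd (Dir 15) (Dir 20) (Dir 16); ICopy (Dir 18) (Ind 15);
      ICopy (Dir 13) (Dir 17); RConst (Ind 7) 1; RJlt (Ind 17) (Ind 18) 71;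
   (* 70 *)
      RSub (Ind 7) (Ind 10) (Ind 7); IJlt (Dir 13) (Dir 18) 73; Jmp 57;
      IAdd (Dir 13) (Dir 13) (Dir 2); RSub (Ind 8) (Ind 17) (Ind 13);
      RMul (Ind 8) (Ind 8) (Ind 7); RJlt (Ind 8) (Ind 10) 81; RJlt (Ind 6) (Ind 8) 79; Jmp 71;
      RCopy (Ind 6) (Ind 8);
   (* 80 *)
      Jmp 71; ICopy (Dir 17) (Dir 13); Jmp 71; RJlt (Ind 10) (Ind 6) 85; Jmp 104;
      IJlt (Dir 2) (Dir 1) 87; Jmp 104; RConst (Ind 9) 1; Jmp 12; IJlt (Dir 2) (Dir 1) 91;
   (* 90 *)
      Jmp 102; RJlt (Ind 3) (Ind 12) 93; Jmp 94; RJlt (Ind 5) (Ind 12) 99;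
      RJlt (Ind 11) (Ind 3) 96; Jmp 102; RJlt (Ind 11) (Ind 5) 98; Jmp 102;
      ICopy (Dir 12) (Dir 11); ICopy (Dir 22) (Dir 12);
   (* 100 *)
      IConst (Dir 14) 2; Jmp 52; IConst (Dir 14) 1; Jmp 52].

(** Specifications below are in continuation style: if [Q] is reached within [N] steps from every
    exit state, it is reached from the entry state within [N] plus the cost of the block. *)
Definition reaches (N : nat) (st : state R) (Q : state R -> Prop) : Prop :=
  exists2 t, (t <= N)%N & Q (run zigzag_program t st).

Lemma reaches_now N (st : state R) (Q : state R -> Prop) : Q st -> reaches N st Q.
Proof. by exists 0%N. Qed.

Lemma reaches_le N N' st Q : (N <= N')%N -> reaches N st Q -> reaches N' st Q.
Proof. by move=> NN' [t tN Qt]; exists t => //; apply: leq_trans NN'. Qed.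

Lemma reaches_step N st i Q : onth zigzag_program (pc st) = Some i ->
  reaches N (exec st i) Q -> reaches N.+1 st Q.
Proof.
by move=> ei [t tN Qt]; exists t.+1 => //; rewrite /run iterSr {2}/step ei.
Qed.

(** * Memory layout *)

Definition imem_of (regs : seq nat) (arr : nat -> nat) : nat -> nat :=
  fun a => if (a < 21)%N then nth 0%N regs a else arr (a - 21)%N.

(** The scratch reals start after the [K + 1] cells [2n .. 2n + K] reserved for the output. *)
Definition cellE := (2 * n + K).+1.
Definition cell_s := cellE.+1.
Definition cellT := cell_s.+1.
Definition cell_rate := cellT.+1.
Definition cell_zero := cell_rate.+1.

(** Past the four scratch reals the default 0 is read, which is the content of [cell_zero]. *)
Definition rmem_of (out : nat -> R) (E s T rate : R) : nat -> R :=
  fun a => if (a < n)%N then D`_a else if (a < 2 * n)%N then f a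
           else if (a <= 2 * n + K)%N then out (a - 2 * n)%N
           else nth 0 [:: E; s; T; rate] (a - cellE).

Lemma imem_reg regs arr a : (a < 21)%N -> imem_of regs arr a = nth 0%N regs a.
Proof. by rewrite /imem_of => ->. Qed.

Lemma imem_arr regs arr t : imem_of regs arr (21 + t) = arr t.
Proof. by rewrite /imem_of ltnNge leq_addr /= addKn. Qed.

Lemma imem_set_reg regs arr a v : (a < 21)%N -> size regs = 21%N ->
  update (imem_of regs arr) a v = imem_of (set_nth 0%N regs a v) arr.
Proof.
move=> a21 sr; apply/funext => b; rewrite /update /imem_of nth_set_nth /=.
by case: eqP => // ->; rewrite a21.
Qed.

Lemma imem_set_arr regs arr t v :
  update (imem_of regs arr) (21 + t) v = imem_of regs (update arr t v).
Proof.
apply/funext => b; rewrite /update /imem_of.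
case: (ltnP b 21) => b21; first by case: eqP => // e; lia.
by have -> : (b == 21 + t)%N = (b - 21 == t)%N by lia.
Qed.

Lemma imem_set_arr0 regs arr v :
  update (imem_of regs arr) 21 v = imem_of regs (update arr 0%N v).
Proof. exact: imem_set_arr regs arr 0%N v. Qed.

Lemma imem_set_arr1 regs arr v :
  update (imem_of regs arr) 22 v = imem_of regs (update arr 1%N v).
Proof. exact: imem_set_arr regs arr 1%N v. Qed.

Lemma rmem_scratch out E s T rate i :
  rmem_of out E s T rate (cellE + i) = nth 0 [:: E; s; T; rate] i.
Proof.
rewrite /rmem_of addKn /cellE.
have -> : ((2 * n + K).+1 + i < n)%N = false by lia.
have -> : ((2 * n + K).+1 + i < 2 * n)%N = false by lia.
by have -> : ((2 * n + K).+1 + i <= 2 * n + K)%N = false by lia.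
Qed.

Lemma rmem_E out E s T rate : rmem_of out E s T rate cellE = E.
Proof. by have := rmem_scratch out E s T rate 0; rewrite addn0. Qed.

Lemma rmem_s out E s T rate : rmem_of out E s T rate cell_s = s.
Proof. by have := rmem_scratch out E s T rate 1; rewrite addn1. Qed.

Lemma rmem_T out E s T rate : rmem_of out E s T rate cellT = T.
Proof. by have := rmem_scratch out E s T rate 2; rewrite addn2. Qed.

Lemma rmem_rate out E s T rate : rmem_of out E s T rate cell_rate = rate.
Proof. by have := rmem_scratch out E s T rate 3; rewrite addn3. Qed.

Lemma rmem_zero out E s T rate : rmem_of out E s T rate cell_zero = 0.
Proof. by have := rmem_scratch out E s T rate 4; rewrite addn4. Qed.

Lemma rmem_height out E s T rate q : (n <= q < 2 * n)%N -> rmem_of out E s T rate q = f q.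
Proof.
move=> hq; rewrite /rmem_of.
have -> : (q < n)%N = false by lia.
by have -> : (q < 2 * n)%N by lia.
Qed.

Lemma rmem_point out E s T rate q : (n <= q < 2 * n)%N ->
  rmem_of out E s T rate (q - n) = abscissa D q.
Proof.
move=> hq; rewrite /rmem_of.
by have -> : (q - n < n)%N by lia.
Qed.

Lemma rmem_set_scratch out E s T rate E' s' T' rate' i v : (i < 4)%N ->
  [:: E'; s'; T'; rate'] = set_nth 0 [:: E; s; T; rate] i v ->
  update (rmem_of out E s T rate) (cellE + i) v = rmem_of out E' s' T' rate'.
Proof.
move=> i4 e; apply/funext => a; rewrite /update; case: eqP => [->|ne].
  by rewrite rmem_scratch e nth_set_nth /= eqxx.
rewrite /rmem_of; case: ltnP => // h1; case: ltnP => // h2; case: leqP => // h3.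
rewrite e nth_set_nth /=; case: eqP => // e'; case: ne.
by rewrite -e' subnKC.
Qed.

Lemma rmem_set_E out E s T rate v :
  update (rmem_of out E s T rate) cellE v = rmem_of out v s T rate.
Proof. by rewrite -[cellE]addn0; apply: rmem_set_scratch. Qed.

Lemma rmem_set_s out E s T rate v :
  update (rmem_of out E s T rate) cell_s v = rmem_of out E v T rate.
Proof. by rewrite /cell_s -addn1; apply: rmem_set_scratch. Qed.

Lemma rmem_set_T out E s T rate v :
  update (rmem_of out E s T rate) cellT v = rmem_of out E s v rate.
Proof. by rewrite /cellT /cell_s -addn2; apply: rmem_set_scratch. Qed.

Lemma rmem_set_rate out E s T rate v :
  update (rmem_of out E s T rate) cell_rate v = rmem_of out E s T v.
Proof. by rewrite /cell_rate /cellT /cell_s -addn3; apply: rmem_set_scratch. Qed.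

Lemma rmem_set_out out E s T rate t v : (t <= K)%N ->
  update (rmem_of out E s T rate) (2 * n + t) v = rmem_of (update out t v) E s T rate.
Proof.
move=> tK; apply/funext => a; rewrite /update /rmem_of.
case: (ltnP a n) => an; first by case: eqP => // e; lia.
case: (ltnP a (2 * n)) => an2; first by case: eqP => // e; lia.
case: (leqP a (2 * n + K)) => an3; last by case: eqP => // e; lia.
by have -> : (a == 2 * n + t)%N = (a - 2 * n == t)%N by lia.
Qed.

(** Variable registers: [lo] and [c] are the addresses of the minimum and maximum while scanning,
    then [c] is the last turning point; [q] is the current point, [k] the number of segments, [p] a
    pointer, [j] the index of a segmentation point, [a] the running maximum in a segment, [b] the
    end of the segment, [x] the address of an abscissa. *)
Local Notation ram l r0 lo c q k p j a b x arr out E s T rate :=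
  (State l
    (imem_of [:: r0; K; 1; n; 2 * n; (2 * n).-1; cellE; cell_s; cellT; cell_rate; cell_zero;
                 lo; c; q; k; p; j; a; b; x; 21]%N arr)
    (rmem_of out E s T rate)).

Ltac simp_mem :=
  repeat match goal with
  | |- context [imem_of ?l ?arr (21 + ?t)] => rewrite (imem_arr l arr t)
  | |- context [imem_of ?l ?arr ?a] => rewrite (imem_reg l arr a erefl) /=
  | |- context [update (imem_of ?l ?arr) (21 + ?t) ?v] => rewrite (imem_set_arr l arr t v)
  | |- context [update (imem_of ?l ?arr) 21 ?v] => rewrite (imem_set_arr0 l arr v)
  | |- context [update (imem_of ?l ?arr) 22 ?v] => rewrite (imem_set_arr1 l arr v)
  | |- context [update (imem_of ?l ?arr) ?a ?v] =>
      rewrite (imem_set_reg l arr a v erefl erefl) /=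
  | |- context [update (rmem_of _ _ _ _ _) cellE _] => rewrite rmem_set_E
  | |- context [update (rmem_of _ _ _ _ _) cell_s _] => rewrite rmem_set_s
  | |- context [update (rmem_of _ _ _ _ _) cellT _] => rewrite rmem_set_T
  | |- context [update (rmem_of _ _ _ _ _) cell_rate _] => rewrite rmem_set_rate
  | |- context [rmem_of _ _ _ _ _ cellE] => rewrite rmem_E
  | |- context [rmem_of _ _ _ _ _ cell_s] => rewrite rmem_s
  | |- context [rmem_of _ _ _ _ _ cellT] => rewrite rmem_T
  | |- context [rmem_of _ _ _ _ _ cell_rate] => rewrite rmem_rate
  | |- context [rmem_of _ _ _ _ _ cell_zero] => rewrite rmem_zero
  end.

Ltac exec1 :=
  apply: reaches_step; [reflexivity|];
  rewrite /exec /iset /rset /goto /ival /rval /address /=; simp_mem.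

(** * Specifications of the loops *)

(** The loop keeps the extrema of the points before [q]. At the exit to 30 the point [q] has just
    become one of them, and the other one is within [E] of all earlier values, as [zigzag_start]
    requires. *)
Lemma scan_spec N Q r0 k p j a b x arr out E s rate : 0 <= rate ->
  (forall lo hi T, (n <= lo < 2 * n)%N -> (n <= hi < 2 * n)%N ->
     (forall y, (n <= y < 2 * n)%N -> f lo <= f y <= f hi) ->
     (f hi - f lo) * rate < E ->
     reaches N (ram 89 r0 lo hi (2 * n) k p j a b x arr out E s T rate) Q) ->
  (forall lo hi q T, (n <= lo <= q)%N -> (n <= hi <= q)%N -> (q < 2 * n)%N ->
     (forall y, (n <= y <= q)%N -> f lo <= f y <= f hi) ->
     E <= (f hi - f lo) * rate ->
     (lo < hi)%N && (hi == q) || (hi < lo)%N && (lo == q) ->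
     (forall y, (n <= y < q)%N ->
        if (lo < hi)%N then (f y - f lo) * rate < E else (f hi - f y) * rate < E) ->
     reaches N (ram 30 r0 lo hi q k p j a b x arr out E s T rate) Q) ->
  forall d q lo hi T, (2 * n <= q + d)%N -> (q <= 2 * n)%N ->
     (n <= lo < q)%N -> (n <= hi < q)%N ->
     (forall y, (n <= y < q)%N -> f lo <= f y <= f hi) ->
     (f hi - f lo) * rate < E ->
  reaches (20 * d + 20 + N) (ram 16 r0 lo hi q k p j a b x arr out E s T rate) Q.
Proof.
move=> rate0 exit1 exit2.
have stop q lo hi T d : q = (2 * n)%N -> (n <= lo < q)%N -> (n <= hi < q)%N ->
     (forall y, (n <= y < q)%N -> f lo <= f y <= f hi) ->
     (f hi - f lo) * rate < E ->
    reaches (d + 20 + N) (ram 16 r0 lo hi q k p j a b x arr out E s T rate) Q.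
  move=> -> h1 h2 h3 h4; apply: (reaches_le (2 + N)); first lia.
  by exec1; rewrite ltnn; exec1; apply: exit1.
elim=> [|d IH] q lo hi T dq q2 hlo hhi rg rtE; first by apply: stop => //; lia.
have [q2n|q2n] := ltnP q (2 * n); last by apply: stop => //; lia.
(* The budget of the later iterations is kept as a variable, so that only the steps of this
   iteration are counted explicitly. *)
pose M := (20 * d + 20 + N)%N; have HM : M = (20 * d + 20 + N)%N by [].
clearbody M; apply: (reaches_le (20 + M)); first lia.
have next lo' hi' T' : (n <= lo' <= q)%N -> (n <= hi' <= q)%N ->
    (forall y, (n <= y <= q)%N -> f lo' <= f y <= f hi') ->
    (f hi' - f lo') * rate < E ->
    reaches (2 + M) (ram 28 r0 lo' hi' q k p j a b x arr out E s T' rate) Q.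
  move=> h1 h2 h3 h4; by exec1; rewrite addn1; exec1; rewrite HM; apply: IH => //; lia.
exec1; rewrite q2n.
exec1; rewrite !rmem_height; [|lia..].
case: ltP => qlo.
  do 5! exec1; rewrite !rmem_height; [|lia..].
  have rg' y : (n <= y <= q)%N -> f q <= f y <= f hi.
    move=> hy; have := rg hi; rewrite hhi => /(_ isT).
    have [->|yq] := eqVneq y q; first by have := rg lo; rewrite hlo => /(_ isT); lra.
    by have := rg y; have -> : (n <= y < q)%N by [lia]; move=> /(_ isT); lra.
  case: ltP => hE.
    by apply: (reaches_le (2 + M)); [lia|apply: next => //; lia].
  exec1; apply: (reaches_le N); [lia|apply: exit2 => //; try lia].
  move=> y hy; have -> : (q < hi)%N = false by lia.
  apply: le_lt_trans rtE; apply: ler_wpM2r => //.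
  by have := rg y hy; lra.
exec1; rewrite !rmem_height; [|lia..].
case: ltP => qhi.
  do 4! exec1; rewrite !rmem_height; [|lia..].
  have rg' y : (n <= y <= q)%N -> f lo <= f y <= f q.
    move=> hy; have := rg lo; rewrite hlo => /(_ isT).
    have [->|yq] := eqVneq y q; first by have := rg hi; rewrite hhi => /(_ isT); lra.
    by have := rg y; have -> : (n <= y < q)%N by [lia]; move=> /(_ isT); lra.
  case: ltP => hE.
    by apply: (reaches_le (2 + M)); [lia|apply: next => //; lia].
  exec1; apply: (reaches_le N); [lia|apply: exit2 => //; try lia].
  move=> y hy; have -> : (lo < q)%N by lia.
  apply: le_lt_trans rtE; apply: ler_wpM2r => //.
  by have := rg y hy; lra.
exec1; apply: (reaches_le (2 + M)); [lia|apply: next => //; try lia].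
move=> y hy; have [->|yq] := eqVneq y q; first by lra.
by apply: rg; lia.
Qed.
(** The three outcomes of comparing [T], the distance by which [f] has come back from the last
    turning point, with 0 and [E] are [zigzag_move], [zigzag_keep] and [zigzag_turn]. The last
    turning point may still move, so it stays in [c] and is stored in [arr] only at the next
    turn. *)
Lemma extend_spec N Q r0 lo j a b x out E rate s0 : 0 < E ->
  (forall k c q q' p arr s T w, zigzag f n E K.+1 s0 w q' -> (q' <= 2 * n)%N ->
     reaches N (ram 104 r0 lo c q k p j a b x arr out E s T rate) Q) ->
  (forall k c p arr s T w, (0 < k <= K)%N -> zigzag f n E k s0 w (2 * n) ->
     arr 0%N = n -> (forall t, (0 < t < k)%N -> arr t = w t) ->
     reaches N (ram 52 r0 lo c (2 * n) k p j a b x arr out E s T rate) Q) ->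
  forall d q k p arr T w, (2 * n <= q + d)%N -> (q <= 2 * n)%N -> (k < K)%N ->
     zigzag f n E k.+1 s0 w q ->
     arr 0%N = n -> (forall t, (0 < t < k.+1)%N -> arr t = w t) ->
  reaches (20 * d + 20 + N)
    (ram 36 r0 lo (w k.+1) q k.+1 p j a b x arr out E (sgn s0 k) T rate) Q.
Proof.
move=> E0 abort exit.
have stop q k p arr T w d : q = (2 * n)%N -> (k < K)%N -> zigzag f n E k.+1 s0 w q ->
    arr 0%N = n -> (forall t, (0 < t < k.+1)%N -> arr t = w t) ->
    reaches (d + 20 + N)
      (ram 36 r0 lo (w k.+1) q k.+1 p j a b x arr out E (sgn s0 k) T rate) Q.
  move=> -> h1 h2 h3 h4; apply: (reaches_le (2 + N)); first lia.
  by exec1; rewrite ltnn; exec1; apply: (exit _ _ _ _ _ _ w).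
elim=> [|d IH] q k p arr T w dq q2 kK zz arr0 arrw; first by apply: stop => //; lia.
have [q2n|q2n] := ltnP q (2 * n); last by apply: stop => //; lia.
pose M := (20 * d + 20 + N)%N; have HM : M = (20 * d + 20 + N)%N by [].
clearbody M; apply: (reaches_le (20 + M)); first lia.
have next k' p' arr' T' w' : (k' < K)%N -> zigzag f n E k'.+1 s0 w' q.+1 ->
    arr' 0%N = n -> (forall t, (0 < t < k'.+1)%N -> arr' t = w' t) ->
    reaches (1 + M)
      (ram 35 r0 lo (w' k'.+1) q k'.+1 p' j a b x arr' out E (sgn s0 k') T' rate) Q.
  move=> h1 h2 h3 h4; by exec1; rewrite addn1 HM; apply: IH => //; lia.
have wq : (n <= w k.+1 < q)%N.
  have w0 := zz_first _ _ _ _ _ _ _ zz; have wl := zz_last _ _ _ _ _ _ _ zz.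
  suff : (w 0 <= w k.+1)%N by lia.
  elim: (k.+1) (zz_lt _ _ _ _ _ _ _ zz) => [//|i IHi] lt.
  have := IHi (fun t ti => lt t (leqW ti)); have := lt i (ltnSn i); lia.
exec1; rewrite q2n; do 2! exec1; rewrite !rmem_height; [|lia..].
exec1; case: ltP => TE.
  exec1; case: ltP => T0.
    do 2! exec1.
    have := next k p arr ((f (w k.+1) - f q) * sgn s0 k) (update w k.+1 q).
    rewrite update_eq // => nx.
    apply: (reaches_le (1 + M)); [lia|apply: nx => //].
      by apply: zigzag_move => //; rewrite sgnS; lra.
    by move=> t tk; rewrite update_neq; [apply: arrw|lia].
  exec1; apply: (reaches_le (1 + M)); [lia|apply: next => //].
  by apply: zigzag_keep => //; rewrite sgnS; lra.
have zz' : zigzag f n E k.+2 s0 (update w k.+2 q) q.+1.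
  by apply: zigzag_turn => //; rewrite sgnS; lra.
do 5! exec1; rewrite addn1 sub0r -sgnS.
exec1; case: ltnP => kK'.
  (* With [K.+1] steps on a prefix of the points the certificate is complete, and the remaining
     points are not scanned. *)
  have kE : k.+2 = K.+1 by lia.
  rewrite kE in zz'; apply: (reaches_le N); first lia.
  by apply: (abort _ _ _ _ _ _ _ _ _ zz').
exec1; have := next k.+1 (21 + k.+1)%N (update arr k.+1 (w k.+1))
  ((f (w k.+1) - f q) * sgn s0 k) _ kK' zz'.
rewrite [update w _ _ _]update_eq // => nx; apply: (reaches_le (1 + M)); [lia|apply: nx].
  by rewrite update_neq.
move=> t tk; have [->|tk'] := eqVneq t k.+1.
  by rewrite update_eq // update_neq //; lia.
have tk2 : t <> k.+1 by apply/eqP.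
rewrite !update_neq; [apply: arrw|..]; lia.
Qed.
Lemma round_spec N Q r0 lo c q k p j a b x arr out E s T :
  (1 < n)%N -> (0 < K)%N -> 0 < E ->
  (exists s' c', (s' = 1 \/ s' = - 1) /\ chain_to f n (2 * n).-1 E 1 s' c') ->
  (forall lo c q k p arr s T s' c', s' = 1 \/ s' = - 1 ->
     chain_to f n (2 * n).-1 E K.+1 s' c' ->
     reaches N (ram 104 r0 lo c q k p j a b x arr out E s T 1) Q) ->
  (forall lo c q k p arr s T s0 w, s0 = 1 \/ s0 = - 1 -> (0 < k <= K)%N ->
     zigzag f n E k s0 w (2 * n) ->
     (forall t, (t <= k)%N -> arr t = breakpoint n (2 * n).-1 w k t) ->
     reaches N (ram 54 r0 lo c q k p j a b x arr out E s T 1) Q) ->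
  reaches (40 * n + 60 + N) (ram 12 r0 lo c q k p j a b x arr out E s T 1) Q.
Proof.
move=> n1 K0 E0 [s1 [c1 [s1u [b1 [b1c st ch1]]]]] abort exit.
pose M := (20 * (n.-1) + 20 + (6 + (20 * n + 20 + (2 + N))))%N.
have HM : M = (20 * (n.-1) + 20 + (6 + (20 * n + 20 + (2 + N))))%N by [].
clearbody M; apply: (reaches_le (4 + M)); first lia.
do 4! exec1; rewrite addn1 HM {M HM}.
apply: scan_spec => //; last first.
- by rewrite subrr mul0r.
- by move=> y hy; have -> : y = n by [lia]; rewrite lexx.
- lia.
- lia.
- lia.
- lia.
- move=> {}lo hi {}q {}T hlo hhi q2n rg; rewrite mulr1 => hE hor small.
  pose M := (20 * n + 20 + (2 + N))%N.
  have HM : M = (20 * n + 20 + (2 + N))%N by [].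
  clearbody M; apply: (reaches_le (6 + M)); first lia.
  have go lo' hi' s0 w p' T' : s0 = 1 \/ s0 = - 1 -> zigzag f n E 1 s0 w q.+1 -> w 1%N = hi' ->
    reaches (1 + M) (ram 35 r0 lo' hi' q 1 p' j a b x (update arr 0%N n) out E s0 T' 1) Q.
    move=> s0u zz <-; exec1; rewrite addn1 HM.
    rewrite -[X in rmem_of _ _ X](sgn0 s0).
    apply: (extend_spec _ _ _ _ _ _ _ _ _ _ _ s0) => //.
    + move=> {}k {}c q' q'' {}p arr' {}s {}T w' zz' q''2.
      apply: (reaches_le N); first lia.
      have qB : (q'' <= (2 * n).-1.+1)%N by lia.
      apply: (abort _ _ _ _ _ _ _ _ _ _ _ (zigzag_chain _ _ _ _ _ _ _ _ qB zz' _ (leqnn _))).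
      by case: (sgn_cases s0 K.+1) => ->; case: s0u => ->; rewrite ?opprK; auto.
    + move=> {}k {}c {}p arr' {}s {}T w' kK zz' arr0 arrw.
      exec1; exec1.
      apply: (exit _ _ _ _ _ _ _ _ s0 w') => //.
      move=> t tk; rewrite /breakpoint /update.
      case: (eqVneq t 0%N) => [->|t0]; first by case: eqP => // k0; lia.
      by case: (eqVneq t k) => // tk'; apply: arrw; lia.
    + lia.
    + by move=> t; lia.
  (* The order of the two extrema gives the direction of the first step; the later one is [q]. *)
  exec1; exec1; exec1; case: ltnP => lohi.
    have hq : hi = q by lia.
    have zz0 : zigzag f n E 0 1 (fun=> lo) q.
      apply: zigzag_start => //; [lia|lia|move=> y hy; rewrite !mul1r].
      have := rg y; have := small y hy; rewrite lohi mulr1 => h1.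
      by have -> : (n <= y <= q)%N by [lia]; move=> /(_ isT); lra.
    apply: (reaches_le (1 + M)); first lia.
    apply: (go _ _ _ (update (fun=> lo) 1 q)); [by left| |by rewrite update_eq].
    by apply: zigzag_turn => //; rewrite sgn0 !mul1r -hq; lra.
  have hq : lo = q by lia.
  have zz0 : zigzag f n E 0 (- 1) (fun=> hi) q.
    apply: zigzag_start => //; [lia|lia|move=> y hy; rewrite !mulN1r].
    have := rg y; have := small y hy; rewrite ltnNge lohi mulr1 /= => h1.
    by have -> : (n <= y <= q)%N by [lia]; move=> /(_ isT); lra.
  exec1; exec1; rewrite sub0r; apply: (reaches_le (1 + M)); first lia.
  apply: (go _ _ _ (update (fun=> hi) 1 q)); [by right| |by rewrite update_eq].
  by apply: zigzag_turn => //; rewrite sgn0 !mulN1r -hq; lra.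
(* The scan cannot run to the end, since the given chain has a step of height at least [E]. *)
- move=> {}lo hi {}T hlo hhi rg; rewrite mulr1 => small.
  simpl in ch1;   have := rg b1; have -> : (n <= b1 < 2 * n)%N by lia.
  have := rg c1; have -> : (n <= c1 < 2 * n)%N by lia.
  by move=> /(_ isT) h1 /(_ isT) h2; case: s1u st => ->; lra.
Qed.
(** The largest drop ending at [q] starts at the running maximum [a] of [s * f]. Both a bound and a
    witness are kept for [E]: the bound controls the error of the segmentation, the witness
    lengthens the chain. *)
Lemma segment_spec N Q r0 lo c k p j x arr out rate s a0 b E0 :
  (n <= a0)%N -> (b < 2 * n)%N -> 0 <= E0 ->
  (forall a E T, 0 <= E -> E0 <= E ->
     (forall u v, (a0 <= u)%N -> (u < v)%N -> (v <= b)%N -> s * f u - s * f v <= E) ->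
     (E = E0 \/ exists u v, [/\ (a0 <= u)%N, (u < v)%N, (v <= b)%N & E <= s * f u - s * f v]) ->
     reaches N (ram 57 r0 lo c b k p j a b x arr out E s T rate) Q) ->
  forall d q a E T, (b <= q + d)%N -> (q <= b)%N -> (a0 <= a <= q)%N ->
     (forall y, (a0 <= y <= q)%N -> s * f y <= s * f a) -> E0 <= E ->
     (forall u v, (a0 <= u)%N -> (u < v)%N -> (v <= q)%N -> s * f u - s * f v <= E) ->
     (E = E0 \/ exists u v, [/\ (a0 <= u)%N, (u < v)%N, (v <= b)%N & E <= s * f u - s * f v]) ->
  reaches (10 * d + 2 + N) (ram 71 r0 lo c q k p j a b x arr out E s T rate) Q.
Proof.
move=> na b2 E00 exit.
have stop d q a E T : q = b -> E0 <= E ->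
     (forall u v, (a0 <= u)%N -> (u < v)%N -> (v <= q)%N -> s * f u - s * f v <= E) ->
     (E = E0 \/ exists u v, [/\ (a0 <= u)%N, (u < v)%N, (v <= b)%N & E <= s * f u - s * f v]) ->
  reaches (d + 2 + N) (ram 71 r0 lo c q k p j a b x arr out E s T rate) Q.
  move=> -> h1 h2 h3; apply: (reaches_le (2 + N)); first lia.
  by exec1; rewrite ltnn; exec1; apply: exit => //; lra.
elim=> [|d IH] q a E T bq qb aq top EE drops att; first by apply: stop => //; lia.
have [q2n|q2n] := ltnP q b; last by apply: stop => //; lia.
pose M := (10 * d + 2 + N)%N; have HM : M = (10 * d + 2 + N)%N by [].
clearbody M; apply: (reaches_le (10 + M)); first lia.
exec1; rewrite q2n; exec1; rewrite addn1; do 2! exec1; rewrite !rmem_height; [|lia..].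
have ra : (a <= q)%N by lia.
exec1; case: ltP => T0.
  do 2! exec1; apply: (reaches_le M); [lia|rewrite HM; apply: IH => //; try lia].
  - move=> y hy; have [->|yq] := eqVneq y q.+1; first by [].
    by have := top y; have -> : (a0 <= y <= q)%N by [lia]; move=> /(_ isT); lra.
  - move=> u v u1 uv vq; have [ev|yq] := eqVneq v q.+1; last by apply: drops => //; lia.
    have := top u; have -> : (a0 <= u <= q)%N by lia.
    by move=> /(_ isT); rewrite ev; lra.
have T0' : s * f q.+1 <= s * f a by lra.
have top' y : (a0 <= y <= q.+1)%N -> s * f y <= s * f a.
  move=> hy; have [->|yq] := eqVneq y q.+1; first by [].
  by apply: top; lia.
exec1; case: ltP => TE.
  do 2! exec1; apply: (reaches_le M); [lia|rewrite HM; apply: IH => //; try lia].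
  - by lra.
  - move=> u v u1 uv vq; have [ev|yq] := eqVneq v q.+1.
      have := top u; have -> : (a0 <= u <= q)%N by lia.
      by move=> /(_ isT); rewrite ev; lra.
    by have := drops u v u1 uv; have -> : (v <= q)%N by [lia]; move=> /(_ isT); lra.
  - by right; exists a, q.+1; split; [lia|lia|lia|lra].
exec1; apply: (reaches_le M); [lia|rewrite HM; apply: IH => //; try lia].
move=> u v u1 uv vq; have [ev|yq] := eqVneq v q.+1; last by apply: drops => //; lia.
have := top u; have -> : (a0 <= u <= q)%N by lia.
by move=> /(_ isT); rewrite ev; lra.
Qed.
Definition segment_sign (P : nat -> nat) (t : nat) : R := if f (P t) < f (P t.+1) then 1 else - 1.

(** The segments are consecutive, so the inner loops telescope to at most [2n - arr j] iterations
    and the cost is linear in [n + k]. *)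
Lemma measure_loop N Q r0 lo c k arr rate : (k <= K)%N ->
  (forall t, (t < k)%N -> (n <= arr t < arr t.+1)%N) -> (n <= arr k < 2 * n)%N ->
  (forall lo c q p j a b x out E s T,
     (forall t, (t <= k)%N -> out t = abscissa D (arr t)) ->
     0 <= E ->
     (forall t u v, (t < k)%N -> (arr t <= u)%N -> (u < v)%N -> (v <= arr t.+1)%N ->
        segment_sign arr t * f u - segment_sign arr t * f v <= E) ->
     (E = 0 \/ exists t u v, [/\ (t < k)%N, (arr t <= u)%N, (u < v)%N, (v <= arr t.+1)%N &
        E <= segment_sign arr t * f u - segment_sign arr t * f v]) ->
     reaches N (ram 83 r0 lo c q k p j a b x arr out E s T rate) Q) ->
  forall d j q p a b x out E s T, (j + d = k)%N ->
     (forall t, (t < j)%N -> out t = abscissa D (arr t)) ->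
     0 <= E ->
     (forall t u v, (t < j)%N -> (arr t <= u)%N -> (u < v)%N -> (v <= arr t.+1)%N ->
        segment_sign arr t * f u - segment_sign arr t * f v <= E) ->
     (E = 0 \/ exists t u v, [/\ (t < k)%N, (arr t <= u)%N, (u < v)%N, (v <= arr t.+1)%N &
        E <= segment_sign arr t * f u - segment_sign arr t * f v]) ->
  reaches (10 * (2 * n - arr j) + 20 * d + 20 + N)
     (ram 57 r0 lo c q k p j a b x arr out E s T rate) Q.
Proof.
move=> kK arr_lt arr_k exit; have arrb t : (t <= k)%N -> (n <= arr t < 2 * n)%N.
  have up i : (t + i <= k)%N -> (arr t <= arr (t + i))%N.
    elim: i => [|i IH] ti; first by rewrite addn0.
    by have := arr_lt (t + i)%N; rewrite addnS in ti *; have := IH (ltnW ti); lia.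
  move=> tk; have := up (k - t)%N; rewrite subnKC // => /(_ (leqnn _)) h.
  have [e|tk'] := eqVneq t k; first by rewrite e in h *; lia.
  by have := arr_lt t; lia.
elim=> [|d IH] j q p a b x out E s T jd outP E0 drops att.
  (* The loop is left after the last point has been written, so [k.+1] points are output. *)
  have jk : j = k by lia.
  pose M := N; have HM : M = N by [].
  clearbody M; rewrite -HM; apply: (reaches_le (7 + M)); first lia.
  have jb := arrb j (leq_trans (leq_addr 0 j) (eq_leq jd)).
  do 5! exec1; rewrite rmem_point; last by [].
  rewrite rmem_set_out; last lia.
  exec1; rewrite jk ltnn; exec1; rewrite HM.
  apply: exit => //.
  - move=> t tk; have [->|tk'] := eqVneq t k; first by rewrite update_eq.
    rewrite update_neq; last by apply/eqP; rewrite eq_sym.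
    by apply: outP; lia.
  - by move=> t u v tk; apply: drops; lia.
have jk : (j < k)%N by lia.
have jb := arrb j (ltnW jk); have j1b := arrb j.+1 jk; have j01 := arr_lt j jk.
pose M := (10 * (2 * n - arr j.+1) + 20 * d + 20 + N)%N.
have HM : M = (10 * (2 * n - arr j.+1) + 20 * d + 20 + N)%N by [].
clearbody M; pose M' := (10 * (arr j.+1 - arr j) + 2 + M)%N.
have HM' : M' = (10 * (arr j.+1 - arr j) + 2 + M)%N by [].
clearbody M'; apply: (reaches_le (15 + M')); first lia.
do 5! exec1; rewrite rmem_point; last by [].
rewrite rmem_set_out; last lia.
exec1; rewrite jk; do 5! exec1; rewrite addn1.
have outP' t : (t < j.+1)%N -> update out j (abscissa D (arr j)) t = abscissa D (arr t).
  move=> tj; have [->|tj'] := eqVneq t j; first by rewrite update_eq.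
  rewrite update_neq; last by apply/eqP; rewrite eq_sym.
  by apply: outP; lia.
have go p' T' : reaches (1 + M') (ram 71 r0 lo c (arr j) k p' j.+1 (arr j) (arr j.+1)
    (arr j - n) arr (update out j (abscissa D (arr j))) E (segment_sign arr j) T' rate) Q.
  apply: (reaches_le M'); first lia.
  rewrite HM'; apply: (segment_spec _ _ _ _ _ _ _ _ _ _ _ _ _ (arr j) _ E) => //; try lia.
  - move=> a' E' T2 E'0 EE drops' att'; rewrite HM; apply: IH => //; first lia.
    + move=> t u v tj u1 uv v2; have [e|tj'] := eqVneq t j.
        by rewrite e in u1 v2 *; apply: drops'.
      by apply: le_trans EE; apply: drops => //; lia.
    + case: att' => [->//|[u [v [u1 uv v2 h]]]].
      by right; exists j, u, v; split.
  - by move=> y hy; have -> : y = arr j by lia.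
  - by left.
exec1; rewrite !rmem_height; [|lia..].
have := go (21 + j.+1)%N T; rewrite /segment_sign; case: ltP => _ {}go.
  by apply: reaches_le go; lia.
by exec1; rewrite sub0r; apply: reaches_le go; lia.
Qed.

Lemma measure_spec N Q r0 lo c q k p j a b x arr out E s T rate : (k <= K)%N ->
  (forall t, (t < k)%N -> (n <= arr t < arr t.+1)%N) -> (n <= arr k < 2 * n)%N ->
  (forall lo c q p j a b x out E s T,
     (forall t, (t <= k)%N -> out t = abscissa D (arr t)) ->
     0 <= E ->
     (forall t u v, (t < k)%N -> (arr t <= u)%N -> (u < v)%N -> (v <= arr t.+1)%N ->
        segment_sign arr t * f u - segment_sign arr t * f v <= E) ->
     (E = 0 \/ exists t u v, [/\ (t < k)%N, (arr t <= u)%N, (u < v)%N, (v <= arr t.+1)%N &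
        E <= segment_sign arr t * f u - segment_sign arr t * f v]) ->
     reaches N (ram 83 k lo c q k p j a b x arr out E s T rate) Q) ->
  reaches (20 * n + 20 * K + 30 + N) (ram 54 r0 lo c q k p j a b x arr out E s T rate) Q.
Proof.
move=> kK arr_lt arr_k exit.
pose M := (10 * (2 * n - arr 0%N) + 20 * k + 20 + N)%N.
have HM : M = (10 * (2 * n - arr 0%N) + 20 * k + 20 + N)%N by [].
clearbody M; apply: (reaches_le (3 + M)); first lia.
do 3! exec1; rewrite HM.
by apply: measure_loop => //; left.
Qed.

(** * Correctness and running time *)

Section Correctness.
Hypotheses (sD : sorted <%R D) (n1 : (1 < n)%N) (K0 : (0 < K)%N).
Let B := (2 * n).-1.
Let Q (st : state R) : Prop :=
  halted zigzag_program st /\ optimal_segmentation D F K (output n st).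
(** Bounds one round: [40n + 60] for the zigzag, [20n + 20K + 30] for the measurement, 5 for the
    final tests. *)
Let C := (60 * n + 20 * K + 200)%N.

Lemma output_ram l k lo c q k' p j a b x arr out E s T rate : (k <= K)%N ->
  output n (ram l k lo c q k' p j a b x arr out E s T rate) = mkseq out k.+1.
Proof.
move=> kK; rewrite /output.
set st := State _ _ _; have -> : imem st 0%N = k by [].
apply/eq_in_map => t; rewrite mem_iota => tk /=; rewrite /rmem_of.
have -> : (2 * n + t < n)%N = false by lia.
have -> : (2 * n + t < 2 * n)%N = false by lia.
have -> : (2 * n + t <= 2 * n + K)%N by lia.
by rewrite addKn.
Qed.

(** Address 104 is the first one past the program. *)
Lemma halt_spec N k lo c q k' p j a b x arr out E s T rate : (k <= K)%N ->
  optimal_segmentation D F K (mkseq out k.+1) ->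
  reaches N (ram 104 k lo c q k' p j a b x arr out E s T rate) Q.
Proof. by move=> kK opt; apply: reaches_now; split; rewrite ?output_ram. Qed.

(* L bounds from below the number of segments of the next greedy segmentation; it increases in each
   round, so that at most d more rounds follow the next one. *)
Definition loop_ok (d : nat) : Prop :=
  forall L k lo c q k' p j a b x arr out E s T s' c', (K < L + d)%N -> (1 < L)%N -> 0 < E ->
    s' = 1 \/ s' = - 1 -> chain_to f n B E L s' c' -> (k <= K)%N ->
    alternating_segmentation_upto D F K (mkseq out k.+1) ->
    OMAFE D F (mkseq out k.+1) <= E / 2 ->
    reaches (C * d.+1) (ram 12 k lo c q k' p j a b x arr out E s T 1) Q.

Lemma segment_signE s0 arr t : s0 = 1 \/ s0 = - 1 ->
  sgn s0 t * f (arr t) < sgn s0 t * f (arr t.+1) -> segment_sign arr t = sgn s0 t.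
Proof.
move=> s0u; rewrite /segment_sign; case: (sgn_unit s0 s0u t) => ->.
  by rewrite !mul1r => ->.
by rewrite !mulN1r ltrN2 => h; rewrite ltNge (ltW h).
Qed.

(** Common end of the first and of the later rounds. Either [E = 0] and the segmentation is optimal
    since errors are nonnegative, or the drop attaining [E] yields, through [prog], a chain that
    entitles to another round. *)
Lemma after_measure d k s0 lo c q k' p j a b x arr out E s T rate :
  loop_ok d -> (1 < K)%N -> (0 < k <= K)%N -> arr 0%N = n -> arr k = B ->
  (forall t, (t < k)%N -> (arr t < arr t.+1)%N) -> s0 = 1 \/ s0 = - 1 ->
  (forall t, (t < k)%N -> sgn s0 t * f (arr t) < sgn s0 t * f (arr t.+1)) ->
  (forall t, (t <= k)%N -> out t = abscissa D (arr t)) ->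
  0 <= E ->
  (forall t u v, (t < k)%N -> (arr t <= u)%N -> (u < v)%N -> (v <= arr t.+1)%N ->
     segment_sign arr t * f u - segment_sign arr t * f v <= E) ->
  (E = 0 \/ exists t u v, [/\ (t < k)%N, (arr t <= u)%N, (u < v)%N, (v <= arr t.+1)%N &
     E <= segment_sign arr t * f u - segment_sign arr t * f v]) ->
  (0 < E -> forall t u v, (t < k)%N -> (arr t <= u)%N -> (u < v)%N -> (v <= arr t.+1)%N ->
     E <= sgn s0 t * f u - sgn s0 t * f v ->
     exists L s' c', [/\ (K < L + d)%N, (1 < L)%N, s' = 1 \/ s' = - 1 &
       chain_to f n B E L s' c']) ->
  reaches (5 + C * d.+1) (ram 83 k lo c q k' p j a b x arr out E s T rate) Q.
Proof.
move=> ok K1 /andP[k0 kK] arr0 arrk arr_lt s0u dir outE E0 drops att prog.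
have zE : mkseq out k.+1 = mkseq (fun t => abscissa D (arr t)) k.+1.
  by apply/eq_in_map => t; rewrite mem_iota => tk; apply: outE; lia.
have alt : alternating_segmentation_upto D F K (mkseq out k.+1).
  rewrite zE; split; [exact: segmentation_points| |by rewrite nb_segments_points].
  exact: (alternating_points D F sD n1 k arr k0 arr0 arrk s0 s0u dir).
have err : OMAFE D F (mkseq out k.+1) <= E / 2.
  rewrite zE.
  apply: (OMAFE_points_le D F sD n1 k arr k0 arr0 arrk arr_lt s0 s0u dir) => // t u v tk *.
  by rewrite -(segment_signE _ _ _ s0u (dir t tk)); apply: drops.
pose M := (C * d.+1)%N; have HM : M = (C * d.+1)%N by [].
clearbody M; rewrite -HM; exec1; case: ltP => Epos.
  exec1; rewrite K1; do 2! exec1.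
  case: att => [E00|[t [u [v [tk u1 uv v2 h]]]]]; first by rewrite E00 ltxx in Epos.
  rewrite (segment_signE _ _ _ s0u (dir t tk)) in h.
  have [L [s' [c' [KL L1 s'u ch]]]] := prog Epos t u v tk u1 uv v2 h.
  apply: (reaches_le M); first lia.
  by rewrite HM; apply: (ok L _ _ _ _ _ _ _ _ _ _ _ _ _ _ _ s' c').
exec1; apply: halt_spec => //; split=> // z _.
apply: le_trans err _; have -> : E = 0 by apply/eqP; rewrite eq_le Epos E0.
by rewrite mul0r /OMAFE bigmax_ge_id.
Qed.

Lemma loop_spec d : (1 < K < n)%N -> loop_ok d.
Proof.
move=> /andP[K1 Kn].
(* [key] is a single round; its assumption about later rounds is void for [d' = 0]. *)
suff key d' : (forall d'', d' = d''.+1 -> loop_ok d'') -> loop_ok d'.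
  by elim: d => [|d IH]; apply: key => // d'' [<-].
move=> IH L k lo c q k' p j a b x arr out E s T s' c' KL L1 E0 s'u ch kK alt err.
pose M := (20 * n + 20 * K + 30 + (5 + C * d'))%N.
have HM : M = (20 * n + 20 * K + 30 + (5 + C * d'))%N by [].
clearbody M; apply: (reaches_le (40 * n + 60 + M)); first by rewrite HM /C; lia.
have [s1 [c1 [s1u ch1]]] := chain_to_trunc _ _ _ _ _ 1 _ _ (ltnW L1) ch.
apply: round_spec => //.
- exists s1, c1; split=> //; case: s1u => ->; case: s'u => ->; rewrite ?opprK; auto.
(* The zigzag needs more than [K] segments: every candidate has error at least [E / 2], which the
   current output does not exceed. *)
- move=> {}lo {}c {}q {}k' {}p {}arr {}s {}T s2 c2 s2u ch2.
  apply: halt_spec => //; split=> // z altz; apply: le_trans err _.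
  exact: (OMAFE_chain_ge D F sD n1 K _ _ _ _ altz s2u ch2).
move=> {}lo {}c {}q {}k' {}p {}arr {}s {}T s0 w s0u /andP[k0 k'K] zz arrE.
have zzB : zigzag f n E k' s0 w B.+1 by rewrite prednK //; lia.
have bp0 := breakpoint0 n B k' w; have bpk := breakpointk n B _ k' w E0 k0.
have smd := breakpoint_drops _ _ _ _ _ _ _ E0 k0 zzB.
have s's0 : s' = s0 \/ s' = - s0.
  by case: s'u => ->; case: s0u => ->; rewrite ?opprK; auto.
have Lk := chain_to_size _ _ _ _ _ _ _ _ _ _ bp0 bpk k0 smd s's0 ch.
(* [L <= k' <= K] excludes [d' = 0]. *)
case: d' {HM} IH KL (HM) => [|d'] IH KL HM'; first lia.
have k1 : (1 < k')%N by lia.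
have arr0 : arr 0%N = n by rewrite arrE.
have arrk : arr k' = B by rewrite arrE.
have arr_lt t : (t < k')%N -> (arr t < arr t.+1)%N.
  by move=> tk; rewrite !arrE ?(ltnW tk) //; apply: (breakpoint_lt _ _ _ _ _ _ _ E0 k0 zzB).
have dir t : (t < k')%N -> sgn s0 t * f (arr t) < sgn s0 t * f (arr t.+1).
  move=> tk; rewrite !arrE ?(ltnW tk) //.
  exact: (breakpoint_direction _ _ _ _ _ _ _ E0 k0 zzB).
have arrb := addresses_bounds D sD n1 k' arr k0 arr0 arrk arr_lt.
rewrite HM'; apply: measure_spec => //.
- by move=> t tk; have := arrb t (ltnW tk); have := arr_lt t tk; lia.
- exact: arrb.
move=> {}lo {}c {}q {}p {}j {}a {}b {}x out' E' {}s {}T outE E'0 drops att.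
apply: (after_measure _ _ s0) => //; [exact: IH|lia|].
move=> E'pos t u v tk u1 uv v2 h.
(* Greedy drops are less than [E], so the zigzag is also a chain for [E'], and inserting the drop
   gives [k'.+1 > L] steps. *)
have EE : E' <= E.
  have := smd t u v tk; rewrite -!arrE ?(ltnW tk) // => /(_ u1 uv v2); lra.
rewrite !arrE ?(ltnW tk) // in u1 v2.
have [s2 [c2 [s2s ch2]]] :=
  breakpoint_progress _ _ _ _ _ _ _ E0 k0 zzB E' t u v E'pos EE tk u1 uv v2 h.
exists k'.+1, s2, c2; split=> //; first lia.
by case: s2s => ->; case: s0u => ->; rewrite ?opprK; auto.
Qed.

Lemma start_spec k s0 w lo c q p j a b x arr out E s T : (K < n)%N -> (0 < k <= K)%N ->
  s0 = 1 \/ s0 = - 1 -> arr 0%N = n -> (forall t, (0 < t < k)%N -> arr t = w t) ->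
  (forall t, (t < k)%N -> (breakpoint n B w k t < breakpoint n B w k t.+1)%N) ->
  ((1 < K)%N -> forall t, (t < k)%N ->
     sgn s0 t * f (breakpoint n B w k t) < sgn s0 t * f (breakpoint n B w k t.+1)) ->
  ((1 < K)%N -> forall e t u v, 0 < e -> (t < k)%N -> (breakpoint n B w k t <= u)%N ->
     (u < v)%N -> (v <= breakpoint n B w k t.+1)%N -> e <= sgn s0 t * f u - sgn s0 t * f v ->
     exists s' c', (s' = s0 \/ s' = - s0) /\ chain_to f n B e 2 s' c') ->
  reaches (20 * n + 20 * K + 40 + C * K) (ram 52 n lo c q k p j a b x arr out E s T 0) Q.
Proof.
move=> Kn /andP[k0 kK] s0u arr0 arrw lt dir prog.
pose M := (20 * n + 20 * K + 30 + (5 + C * K))%N.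
have HM : M = (20 * n + 20 * K + 30 + (5 + C * K))%N by [].
clearbody M; apply: (reaches_le (2 + M)); first lia.
do 2! exec1; rewrite HM {M HM}.
set arr' := update arr k _.
have arrE t : (t <= k)%N -> arr' t = breakpoint n B w k t.
  move=> tk; rewrite /arr' /breakpoint /update.
  case: (eqVneq t 0%N) => [->|t0]; first by case: eqP => // k0'; lia.
  by case: (eqVneq t k) => // tk'; apply: arrw; lia.
have arr'0 : arr' 0%N = n by rewrite arrE.
have arr'k : arr' k = B by rewrite /arr' update_eq.
have arr_lt t : (t < k)%N -> (arr' t < arr' t.+1)%N.
  by move=> tk; rewrite !arrE ?(ltnW tk) //; apply: lt.
have arrb := addresses_bounds D sD n1 k arr' k0 arr'0 arr'k arr_lt.
apply: measure_spec => //.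
- by move=> t tk; have := arrb t (ltnW tk); have := arr_lt t tk; lia.
- exact: arrb.
move=> {}lo {}c {}q {}p {}j {}a {}b {}x {}out {}E {}s {}T outE E0 drops att.
have [K1|K1] := ltnP 1 K; last first.
  have KE : K = 1%N by lia.
  have kE : k = 1%N by lia.
  have opt : optimal_segmentation D F K (mkseq out k.+1).
    have -> : mkseq out k.+1 = [:: abscissa D n; abscissa D B].
      rewrite kE /mkseq /= outE // outE; last by rewrite kE.
      by rewrite arr'0 -[in LHS]kE arr'k.
    by rewrite [K]KE; apply: optimal_one_segment.
  pose M := (C * K)%N; have HM : M = (C * K)%N by [].
  clearbody M; rewrite -HM; exec1; case: ltP => _.
    by exec1; rewrite ltnNge K1; exec1; apply: halt_spec.
  by exec1; apply: halt_spec.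
(* The first chain has [L = 2] steps, and [K < 2 + (K - 1)]. *)
have -> : (C * K = C * K.-1.+1)%N by rewrite prednK.
apply: (after_measure K.-1 k s0) => //.
- by apply: loop_spec; rewrite K1.
- by rewrite k0.
- by move=> t tk; rewrite !arrE ?(ltnW tk) //; apply: dir.
- move=> Epos t u v tk u1 uv v2 h; rewrite !arrE ?(ltnW tk) // in u1 v2.
  have [s' [c' [ss ch]]] := prog K1 E t u v Epos tk u1 uv v2 h.
  exists 2, s', c'; split=> //; first lia.
  by case: ss => ->; case: s0u => ->; rewrite ?opprK; auto.
Qed.

(** If the maximum or the minimum lies strictly beyond both end values, cutting there gives two
    segments. Otherwise both extreme values are taken at the ends of the range and one segment
    suffices. *)
Lemma first_segmentation_spec lo hi k p j a b x arr out E s T :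
  (forall i, (i.+1 < n)%N -> F D`_i <> F D`_i.+1) -> (K < n)%N ->
  arr 0%N = n ->
  (n <= lo < 2 * n)%N -> (n <= hi < 2 * n)%N ->
  (forall y, (n <= y < 2 * n)%N -> f lo <= f y <= f hi) ->
  reaches (20 * n + 20 * K + 50 + C * K)
    (ram 89 n lo hi (2 * n) k p j a b x arr out E s T 0) Q.
Proof.
move=> ndeg Kn arr0 hlo hhi rg.
pose M := (20 * n + 20 * K + 40 + C * K)%N.
have HM : M = (20 * n + 20 * K + 40 + C * K)%N by [].
clearbody M; apply: (reaches_le (10 + M)); first lia.
(* The first two values differ, so [F] is not constant on [D]; this gives the single segment a
   direction. *)
have lohi : f lo < f hi.
  have := rg n; have := rg n.+1; have -> : (n <= n < 2 * n)%N by lia.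
  have -> : (n <= n.+1 < 2 * n)%N by lia.
  move=> /(_ isT) h1 /(_ isT) h2; rewrite ltNge; apply/negP => h.
  case: (ndeg 0%N n1); move: h h1 h2; rewrite /height /abscissa subnn subSnn => h h1 h2.
  by apply/eqP; rewrite eq_le; apply/andP; split; lra.
have one lo' : ((1 < K)%N -> exists s0 : R, [/\ s0 = 1 \/ s0 = - 1,
      (forall y, (n <= y <= B)%N -> s0 * f n <= s0 * f y) & s0 * f n < s0 * f B]) ->
    reaches (2 + M) (ram 102 n lo' hi (2 * n) k p j a b x arr out E s T 0) Q.
  move=> h; do 2! exec1; rewrite HM.
  have [s0 [s0u s0h]] : exists s0 : R, (s0 = 1 \/ s0 = - 1) /\ ((1 < K)%N ->
      (forall y, (n <= y <= B)%N -> s0 * f n <= s0 * f y) /\ s0 * f n < s0 * f B).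
    have [K1|K1] := ltnP 1 K; last by exists 1; split; [left|].
    by have [s0 [h1 h2 h3]] := h K1; exists s0; split.
  apply: (start_spec 1 s0 (fun=> n)) => //.
  - by move=> t; lia.
  - by case=> // _; rewrite /breakpoint /= /B; lia.
  - by move=> /s0h[_ nB] [|//] _; rewrite sgn0.
  - move=> /s0h[mn _] e [|//] u v e0 _; rewrite sgn0 => u1 uv v2 h'.
    exists (- s0), v; split; first by right.
    exact: (slope_chain _ _ _ _ _ u v mn e0 u1 uv v2 h').
have two s0 h lo' : (1 < K)%N -> s0 = 1 \/ s0 = - 1 -> (n <= h < 2 * n)%N ->
    (forall y, (n <= y < 2 * n)%N -> s0 * f y <= s0 * f h) ->
    s0 * f n < s0 * f h -> s0 * f B < s0 * f h ->
    reaches (3 + M) (ram 99 n lo' h (2 * n) k p j a b x arr out E s T 0) Q.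
  move=> K1 s0u hh mx nh Bh; do 3! exec1; rewrite HM.
  have nh' : (n < h)%N.
    rewrite ltn_neqAle; have [/= -> _] := andP hh; rewrite andbT.
    by apply/eqP => e; rewrite -e ltxx in nh.
  have hB' : (h < B)%N.
    rewrite ltn_neqAle; apply/andP; split; last by rewrite /B; lia.
    by apply/eqP => e; rewrite e ltxx in Bh.
  apply: (start_spec 2 s0 (fun=> h)) => //.
  - by move=> [|[|]].
  - by move=> [|[|]] //.
  - by move=> _ [|[|]] //= _; rewrite /breakpoint /= ?sgnS sgn0 //; lra.
  - move=> _ e t u v e0 t2 u1 uv v2 h'.
    apply: (peak_chain _ _ _ s0 h e t u v _ _ e0 t2 u1 uv v2 h'); first by lia.
    by move=> y hy; apply: mx; move: hy; rewrite /B; lia.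
have nb : (n <= B < 2 * n)%N by rewrite /B; lia.
have nn : (n <= n < 2 * n)%N by lia.
have rn := rg n nn; have rB := rg B nb.
exec1; case: (ltnP 1 K) => K1; last first.
  exec1; apply: (reaches_le (2 + M)); [lia|apply: one => K1'; lia].
exec1; rewrite !rmem_height; [|lia..].
have inB y : (n <= y <= B)%N -> (n <= y < 2 * n)%N by clear -n1; rewrite /B; lia.
have one' : (f hi <= f n \/ f hi <= f B) -> (f n <= f lo \/ f B <= f lo) ->
    reaches (2 + M) (ram 102 n lo hi (2 * n) k p j a b x arr out E s T 0) Q.
  move=> h1 h2; apply: one => _.
  have [nlo|nlo] := leP (f n) (f lo).
    exists 1; split; [by left| |by rewrite !mul1r; case: h1; lra].
    by move=> y hy; have := rg y; rewrite !mul1r => /(_ (inB y hy)); lra.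
  have Blo : f B <= f lo by case: h2 => //; lra.
  exists (- 1); split; [by right| |by rewrite !mulN1r; case: h1; lra].
  by move=> y hy; have := rg y; rewrite !mulN1r => /(_ (inB y hy)); case: h1; lra.
have low : (f hi <= f n \/ f hi <= f B) ->
    reaches (6 + M) (ram 94 n lo hi (2 * n) k p j a b x arr out E s T 0) Q.
  move=> h1; exec1; rewrite !rmem_height //.
  case: ltP => nlo;
    last by exec1; apply: (reaches_le (2 + M)); [clear; lia|apply: one' => //; left].
  exec1; rewrite !rmem_height //.
  case: ltP => Blo;
    last by exec1; apply: (reaches_le (2 + M)); [clear; lia|apply: one' => //; right].
  exec1; apply: (two (- 1)) => //; [by right| |lra|lra].
  by move=> y hy; have := rg y hy; lra.
case: ltP => nh; last by exec1; apply: (reaches_le (6 + M)); [clear; lia|apply: low; left].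
exec1; rewrite !rmem_height //.
case: ltP => Bh; last by apply: (reaches_le (6 + M)); [clear; lia|apply: low; right].
apply: (reaches_le (3 + M)); [clear; lia|apply: (two 1) => //; [by left| |lra|lra]].
by move=> y hy; have := rg y hy; lra.
Qed.

Lemma program_spec : (K < n)%N -> (forall i, (i.+1 < n)%N -> F D`_i <> F D`_i.+1) ->
  reaches (1000 * (n * K)) (input D F K) Q.
Proof.
move=> Kn ndeg.
pose M := (20 * n.-1 + 20 + (20 * n + 20 * K + 50 + C * K))%N.
have HM : M = (20 * n.-1 + 20 + (20 * n + 20 * K + 50 + C * K))%N by [].
apply: (@reaches_le (16 + M)).
  (* The dominant term is [C * K]; its part [20 * K * K] is below [20 * n * K] because [K < n]. *)
  by rewrite HM /C; nia.
clearbody M.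
have -> : input D F K = State 0 (imem_of [:: n; K; 0; 0; 0; 0; 0; 0; 0; 0; 0; 0; 0; 0; 0;
    0; 0; 0; 0; 0; 0]%N (fun=> 0%N)) (rmem_of (fun=> 0) 0 0 0 0).
  rewrite /input; congr State; apply/funext => i.
    by rewrite /imem_of; do 21! (case: i => [//|i]).
  rewrite nth_cat /rmem_of; case: ltnP => // ni.
  case: ltnP => ni2; first by rewrite (nth_map 0); [exact: erefl|rewrite ltn_subLR // addnn -mul2n].
  rewrite nth_default; last by rewrite size_map leq_subRL // addnn -mul2n.
  by case: leqP => // _; case: (_ - _)%N => [|[|[|[|m]]]] //=; rewrite nth_nil.
do 3! exec1; rewrite addnn -mul2n.
do 3! exec1; rewrite subn1 addn1 -/cellE.
exec1; rewrite addn1 -/cell_s.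
exec1; rewrite addn1 -/cellT.
exec1; rewrite addn1 -/cell_rate.
exec1; rewrite addn1 -/cell_zero.
do 6! exec1; rewrite addn1.
rewrite HM; apply: scan_spec => //.
- move=> lo hi T hlo hhi rg _; exact: first_segmentation_spec.
(* With rate 0 and threshold 1 the scan never stops early. *)
- by move=> lo hi q T _ _ _ _; rewrite mulr0 ler10.
- by clear -n1; lia.
- by clear -n1; lia.
- by rewrite leqnn ltnSn.
- by rewrite leqnn ltnSn.
- by move=> y; rewrite ltnS -eqn_leq => /eqP <-; rewrite lexx.
- by rewrite mulr0 ltr01.
Qed.

End Correctness.
End Machine.

Theorem mainTheorem3 (R : realType) :
  exists (p : program) (c : nat),
  forall (D : seq R) (F : R -> R) (K : nat),
    sorted <%R D ->
    (forall i : nat, (i.+1 < size D)%N -> F D`_i <> F D`_i.+1) ->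
    (1 <= K)%N ->
    (K.+1 <= #|extrema D F|)%N ->
    exists t : nat,
      [/\ (t <= c * (size D * K))%N,
          halted p (run p t (input D F K)) &
          optimal_segmentation D F K
            (output (size D) (run p t (input D F K)))].
Proof.
exists zigzag_program, 1000%N => D F K sD ndeg K0 Kext.
(* Extrema are indexed by [D], so there are at most [size D] of them. *)
have Kn : (K < size D)%N by apply: leq_trans Kext _; rewrite -[leqRHS]card_ord max_card.
have [t tN [ht opt]] := program_spec D F K sD (leq_ltn_trans K0 Kn) K0 Kn ndeg.
by exists t.
Qed.
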